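(* Let $G$ be a locally graded insoluble parahamiltonian group. Then $G\cong A_5$.
   Context: A group is locally graded if every non-trivial finitely generated subgroup of it contains a proper subgroup of finite index. A group is minimal non-abelian if it is not abelian but all its proper subgroups are abelian. A group $G$ is parahamiltonian if $G$ is non-abelian and every non-normal subgroup of $G$ is either abelian or minimal non-abelian. The group $G$ is not assumed to be finite. *)

(* Defs.v *)
From HB Require Import structures.
From mathcomp Require Import all_boot.
From mathcomp Require Import boolp classical_sets cardinality.

Set Implicit Arguments.
Unset Strict Implicit.
Unset Printing Implicit Defensive.

Local Open Scope group_scope.
Local Open Scope classical_set_scope.

(* Groups are arbitrary, possibly infinite, groupType's; their subgroups are
   Prop-valued sets of elements. *)

Section Subgroups.
Variable G : groupType.
Implicit Types A H K : set G.

Definition subgroup H : Prop := H 1 /\ forall x y, H x -> H y -> H (x / y).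

Definition generated A : set G := smallest subgroup A.

Definition finitely_generated H : Prop :=
  exists A, finite_set A /\ H = generated A.

(* Only meant for subgroups K of H. *)
Definition finite_index K H : Prop :=
  finite_set [set [set x * k | k in K] | x in H].

Definition normal_subgroup H : Prop := forall x g : G, H x -> H (x ^ g).

Definition abelian_subgroup H : Prop :=
  forall x y, H x -> H y -> x * y = y * x.

Definition minimal_nonabelian H : Prop :=
  ~ abelian_subgroup H /\
  forall K, subgroup K -> K `<` H -> abelian_subgroup K.

Definition derived_subgroup H : set G :=
  generated [set [~ x, y] | x in H & y in H].

End Subgroups.

Definition soluble (G : groupType) : Prop :=
  exists n, iter n (@derived_subgroup G) [set: G] = [set 1].

Definition locally_graded (G : groupType) : Prop :=
  forall H : set G, subgroup H -> finitely_generated H -> H <> [set 1] ->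
  exists K : set G, [/\ subgroup K, K `<` H & finite_index K H].

Definition parahamiltonian (G : groupType) : Prop :=
  ~ abelian_subgroup [set: G] /\
  forall H : set G, subgroup H -> ~ normal_subgroup H ->
    abelian_subgroup H \/ minimal_nonabelian H.

Definition isomorphic (G K : groupType) : Prop :=
  exists f : {multiplicative G -> K}, bijective f.

(* Main.v *)
(* A nonmetabelian subgroup of G is normal, and so are all the subgroups above it;
   the quotient by it is then a Dedekind group, so that it contains M = G''.
   Hence M is perfect and finitely generated, and local gradedness gives a
   nonabelian finite simple quotient S of M.  The preimage of a nontrivial proper
   subgroup of S is not normal in G, hence is abelian or minimal nonabelian, so
   that the proper subgroups of the proper subgroups of S are abelian.

   In S every Sylow subgroup P is abelian and disjoint from its conjugates, and
   N(P) is a Frobenius group with kernel P and a complement of prime order.  Such a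
   group of odd order is excluded by Suzuki's method of exceptional characters; in
   even order, counting the pairs of involutions yields |S| = 60, and
   the cosets of the normaliser of a Sylow 2-subgroup identify S with A_5.

   The kernel K of M -> S centralises the preimages of all the Sylow subgroups,
   so it is central; since M is perfect, the transfer to the preimage
   of P gives k^|S : P| = 1 for k in K and all P, whence K = 1.  Finally G = M by
   a Frattini argument. *)

Require Import Defs.
From HB Require Import structures.
From mathcomp Require Import boolp classical_sets cardinality.
From mathcomp Require Import all_boot all_order all_algebra all_fingroup.
From mathcomp Require Import all_solvable all_field all_character alt zify ring.

Set Implicit Arguments.
Unset Strict Implicit.
Unset Printing Implicit Defensive.

(** * Abelian Sylow subgroups and transfer *)

Section BurnsideTransfer.
Import GroupScope FiniteModule.

Variable gT : finGroupType.
Implicit Types G H K P Q R S : {group gT}.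

(** Tarski monsters are insoluble and parahamiltonian, so local gradedness has to enter early: it
    makes minimal nonabelian subgroups metabelian, and metabelian against nonmetabelian is the
    dichotomy that drives the reduction to a finite group.

    On the finite side only one property of [S] remains: each proper subgroup is abelian or minimal
    nonabelian. Finite minimal nonabelian groups have a known structure, and applying it to
    normalisers and centralisers yields ['C_S[x] = P] for every nontrivial [x] in a Sylow subgroup
    [P]. The nontrivial elements of [S] are therefore sorted by primes, and both parities become
    counts indexed by the primes dividing the order.

    In even order let [q] be the index of a Sylow 2-subgroup in its normaliser and [m] the number of
    involutions. Then the Sylow 2-subgroup has order [q + 1], the group has order [(q + 1) * m], and
    counting pairs gives [2 * m = 2 * q + (q + 1) * s], with [s] the sum of [p - 1] over the odd
    primes [p] whose Sylow normaliser is dihedral. Divisibility leaves the primes 3 and 5, [q = 3]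
    and [m = 15]; this is the origin of 60. *)

Lemma abelian_Sylow_fusion p S P x u :
  p.-Sylow(S) P -> abelian P -> 'N_S(P) \subset 'C(P) ->
  u \in S -> x \in P -> x ^ u \in P -> x ^ u = x.
Proof.
move=> sylP abP cNP Su Px Pxu; have sPS := pHall_sub sylP.
have sylC Q : p.-Sylow(S) Q -> Q \subset 'C[x] -> p.-Sylow('C_S[x]) Q.
  move=> sylQ cQ; apply: (pHall_subl _ (subsetIl _ _) sylQ).
  by rewrite subsetI cQ (pHall_sub sylQ).
have sylPC : p.-Sylow('C_S[x]) P.
  by apply: sylC => //; rewrite -cent_set1 centsC sub1set (subsetP abP).
have sylPuC : p.-Sylow('C_S[x]) (P :^ u^-1).
  apply: sylC; first by rewrite pHallJ ?groupV.
  by rewrite sub_conjgV -cent1J -cent_set1 centsC sub1set (subsetP abP).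
(* Both [P] and [P :^ u^-1] are Sylow in ['C_S[x]]; conjugating one to the other by [c] makes
   [c * u] normalise, hence centralise, [P]. *)
have [c /setIP[Sc cxc] /= Ec] := Sylow_trans sylPC sylPuC.
have cu : c * u \in 'C(P).
  apply: (subsetP cNP); rewrite inE groupM //=.
  by apply/normP; rewrite conjsgM -Ec conjsgKV.
have xc : x ^ c = x by apply/conjg_fixP/commgP; apply/cent1P; rewrite cent1C.
have xcu : x ^ (c * u) = x by apply/conjg_fixP/commgP/commute_sym/(centP cu).
by rewrite conjgM xc in xcu.
Qed.

(** Burnside: without fusion in [P], every factor of the transfer of [g] in [P] is a power of [g]
    itself, so [g] is sent to [g ^+ #|S : P|], which is nontrivial because the index is prime to
    [p]. The kernel is then trivial, and [S] embeds in an abelian group. *)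
Lemma simple_Sylow_norm_cent p S P :
  simple S -> ~~ abelian S -> p.-Sylow(S) P -> P :!=: 1 -> abelian P ->
  ~~ ('N_S(P) \subset 'C(P)).
Proof.
move=> simS nabS sylP ntP abP; apply/negP=> cNP; have sPS := pHall_sub sylP.
have abaP : abelian (idm P @* P) by rewrite morphim_idm.
pose V := [morphism of transfer S abaP].
have [/trivgPn[g Pg ntg] pP] := (ntP, pHall_pgroup sylP).
have Sg := subsetP sPS g Pg.
have [X trX] : exists X, is_transversal X (rcosets P S :* <[g]>) S.
  exists (transversal (rcosets P S :* <[g]>) S).
  by apply: transversalP; apply: rcosets_cycle_partition.
have sXG := subsetP (transversal_sub trX).
have Pn x : x \in X -> (g ^+ #|<[g]> : P :* x|) ^ x^-1 = g ^+ #|<[g]> : P :* x|.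
  move=> Xx; apply: (abelian_Sylow_fusion sylP); rewrite ?groupV ?sXG ?groupX //.
  have := mulg_exp_card_rcosets P g x.
  by rewrite mem_rcoset conjgE invgK mulgA.
have Vg : transfer S abaP g = (fmod abaP g *+ #|S : P|)%R.
  rewrite (transfer_cycle_expansion sPS abaP Sg trX).
  rewrite -(sum_index_rcosets_cycle sPS Sg trX) -GRing.sumrMnr.
  by apply: eq_bigr => x Xx; rewrite Pn //= /restrm /= fmodX //= morphim_idm.
have nVg : transfer S abaP g != 0%R.
  rewrite Vg -fmodX /= ?morphim_idm //; apply/eqP => E.
  have := congr1 val E; rewrite fmodK /= ?morphim_idm ?groupX // fmval0 => /eqP.
  rewrite -order_dvdn => ogd.
  have /andP[_] := pHall_Hall sylP.
  move/(coprime_dvdl (order_dvdG Pg)); rewrite /coprime (gcdn_idPl ogd).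
  by rewrite order_eq1 (negPf ntg).
have /simpleP[_ /(_ _ (ker_normal V))[k1|kS]] := simS.
  have injV : 'injm V by apply/trivgP.
  case/negP: nabS; rewrite -(injm_abelian injV) //.
  by apply/centsP=> a _ b _; exact: GRing.addrC.
have : g \in 'ker V by rewrite kS.
by move/mker => E; case/eqP: nVg.
Qed.

End BurnsideTransfer.

(** * Simple groups with abelian second maximal subgroups *)

Section AbelianSecondMaximal.
Import GroupScope.

(* Burnside's transfer argument: some Sylow subgroup P would be central in its
   normaliser. *)
Lemma simple_proper_abelian (gT : finGroupType) (S : {group gT}) :
  simple S -> (forall K : {group gT}, K \proper S -> abelian K) -> abelian S.
Proof.
move=> simS abS; have [//|nabS] := boolP (abelian S).
have ntS : S :!=: 1 by apply: contraNneq nabS => ->; rewrite abelian1.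
pose p := pdiv #|S|; have [P sylP] := Sylow_exists p S.
have ntP : P :!=: 1.
  rewrite -cardG_gt1 (card_Hall sylP) p_part_gt1 pi_pdiv cardG_gt1 //.
have prP (H : {group gT}) : P \subset H -> H \subset 'N(P) -> H \subset S -> abelian H.
  move=> sPH nPH sHS; have [E|] := eqVneq (gval H) S; last first.
    by move=> neq; apply: abS; rewrite properEneq neq.
  have /simpleP[_ /(_ P)] := simS.
  rewrite /normal (pHall_sub sylP) -E nPH => /(_ isT)[P1|PS].
    by rewrite P1 eqxx in ntP.
  have := pgroup_sol (pHall_pgroup sylP); rewrite PS E => solS.
  have /prime_cyclic/cyclic_abelian := simple_sol_prime solS simS.
  by rewrite (negPf nabS).
have abP : abelian P by apply: prP; rewrite ?normG ?(pHall_sub sylP).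
have abN : abelian 'N_S(P).
  by apply: prP; rewrite ?subsetIl ?subsetIr ?subsetI ?normG ?(pHall_sub sylP).
case/negP: (simple_Sylow_norm_cent simS nabS sylP ntP abP).
by apply: centsS abN; rewrite subsetI normG (pHall_sub sylP).
Qed.

(** * Finite groups with abelian proper subgroups *)

Section ProperAbelian.
Variable gT : finGroupType.
Implicit Types G H K N P Q R S : {group gT}.

(** A maximal normal subgroup [L] is abelian, and [N / L] is simple with abelian proper subgroups,
    hence abelian. *)
Lemma proper_abelian_sol N :
  (forall K, K \proper N -> abelian K) -> solvable N.
Proof.
move=> abN; have [->|ntN] := eqVneq (gval N) 1; first exact: solvable1.
have [L maxL] := ex_maxnormal_ntrivg ntN.
have /andP[nsLN _] := maxgroupp maxL.
have [/andP[prL nLN] _] := maxgroupP maxL.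
have nLN' : L <| N by rewrite /normal (proper_sub prL) nLN.
rewrite (series_sol nLN') (abelian_sol (abN _ prL)) /= abelian_sol //.
apply: simple_proper_abelian; first by rewrite quotient_simple.
move=> K prK; have [sKN neqK] := andP prK.
have [H defK sLH sHN] := inv_quotientS nLN' sKN.
rewrite defK quotient_abelian // abN // properEneq sHN andbT.
by apply: contraNneq neqK => E; rewrite defK E.
Qed.

(** The Miller-Moreno structure of finite minimal nonabelian groups. The [q']-part [R] of an abelian
    normal subgroup of prime index [q] is a normal complement to a Sylow [q]-subgroup [Q]; the rest
    comes from comparing [N] with the subgroups [A <*> B], [A] in [R] and [B] in [Q]. *)
Lemma proper_abelian_cases N :
    ~~ abelian N -> (forall K, K \proper N -> abelian K) ->
  (exists p : nat, p.-group N) \/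
  exists p q R Q,
    [/\ prime p, prime q, p != q, p.-Sylow(N) R & q.-Sylow(N) Q] /\
    [/\ R ><| Q = N, abelian R, cyclic Q, ~~ (Q \subset 'C(R))
      & forall R1, R1 \proper R -> Q \subset 'N(R1) -> R1 :=: 1].
Proof.
move=> nabN abN; have solN := proper_abelian_sol abN.
have ntN : N :!=: 1 by apply: contraNneq nabN => ->; rewrite abelian1.
have [L nLN prL] := sol_prime_factor_exists solN ntN.
have [sLN nLN'] := andP nLN.
set q := #|N : L| in prL *.
have properL : L \proper N.
  rewrite properEneq sLN andbT; apply: contraTneq prL => E.
  by rewrite /q E indexgg.
have abL := abN _ properL.
pose R := 'O_q^'(L)%G.
have nRN : R <| N by apply: char_normal_trans (pcore_char _ _) nLN.
have hallRL : q^'.-Hall(L) R by apply: nilpotent_pcore_Hall (abelian_nil abL).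
have hallR : q^'.-Hall(N) R.
  have q1 : partn q q^' = 1%N by rewrite part_p'nat // pnatNK pnat_id.
  rewrite pHallE (normal_sub nRN) (card_Hall hallRL) -(Lagrange sLN) partnM //.
  by rewrite -/q q1 muln1 eqxx.
have [Q sylQ] := Sylow_exists q N.
have [sRN nRN'] := andP nRN; have sQN := pHall_sub sylQ.
have coRQ : coprime #|R| #|Q|.
  by rewrite coprime_sym (pnat_coprime (pHall_pgroup sylQ) (pHall_pgroup hallR)).
have nRQ : Q \subset 'N(R) := subset_trans sQN nRN'.
have defN : R ><| Q = N.
  apply/eqP; rewrite sdprodE ?coprime_TIg // eqEcard mul_subG //=.
  rewrite (coprime_cardMg coRQ) (card_Hall hallR) (card_Hall sylQ) mulnC.
  by rewrite partnC.
have abR : abelian R by apply: abelianS abL; apply: pcore_sub.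
have [R1|ntR] := eqVneq (gval R) 1.
  left; exists q; have := pHall_pgroup sylQ.
  by rewrite -defN R1 sdprod1g.
have cardN : (#|R| * #|Q| = #|N|)%N by rewrite (sdprod_card defN).
have abQ : abelian Q.
  apply: abN; rewrite properEcard sQN -cardN -[X in (X < _)%N]mul1n.
  by rewrite ltn_pmul2r // cardG_gt1.
have ncRQ : ~~ (Q \subset 'C(R)).
  apply: contra nabN => cRQ; have [_ <- _ _] := sdprodP defN.
  by rewrite abelianM abR abQ.
right.
(* If [B] acts nontrivially on [A], then [A <*> B] is nonabelian, so it is [N], and orders force
   [A = R] and [B = Q]. *)
have abRQ (A B : {group gT}) : A \subset R -> B \subset Q -> B \subset 'N(A) ->
     ~~ (B \subset 'C(A)) -> A :=: R /\ B :=: Q.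
  move=> sAR sBQ nAB ncAB.
  have AB_N : A <*> B = N.
    have sABN : A <*> B \subset N.
      by rewrite join_subG (subset_trans sAR) // (subset_trans sBQ).
    apply: contraNeq ncAB => neq.
    have := abN (A <*> B)%G; rewrite properEneq sABN neq => /(_ isT) abAB.
    by apply: (sub_abelian_cent2 abAB); rewrite ?joing_subl ?joing_subr.
  have cAB : coprime #|A| #|B| := coprimeSg sAR (coprimegS sBQ coRQ).
  have EC : (#|A| * #|B| = #|R| * #|Q|)%N.
    by rewrite cardN -AB_N norm_joinEr // coprime_cardMg.
  have [leA leB] := (subset_leq_card sAR, subset_leq_card sBQ).
  split; apply/eqP; rewrite eqEcard ?sAR ?sBQ /= leqNgt; apply/negP => lt.
    have : #|A| * #|B| < #|R| * #|Q| by rewrite (leq_trans _ (leq_mul (leqnn _) leB)) // ltn_pmul2r.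
    by rewrite EC ltnn.
  have : #|A| * #|B| < #|R| * #|Q| by rewrite (leq_trans _ (leq_mul leA (leqnn _))) // ltn_pmul2l.
  by rewrite EC ltnn.
have [P sylP ncP] : exists2 P : {group gT}, Sylow R P & ~~ (Q \subset 'C(P)).
  apply/exists_inP; apply: contraR ncRQ; rewrite negb_exists_in => /forall_inP cQ.
  rewrite centsC -(Sylow_gen R) gen_subG; apply/bigcupsP=> P sylP.
  by rewrite centsC -[_ \subset _]negbK cQ.
have [p prp sylp] := SylowP _ _ sylP; have sPR := pHall_sub sylp.
have nPQ : Q \subset 'N(P).
  rewrite (nilpotent_Hall_pcore (abelian_nil abR) sylp).
  by rewrite (char_norm_trans (pcore_char p R)).
have [PR _] := abRQ _ _ sPR (subxx Q) nPQ ncP.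
have pR : p.-group R by rewrite -PR (pHall_pgroup sylp).
have q'p : p \in q^'.
  apply: (pgroupP (pHall_pgroup hallR) p prp); rewrite -PR.
  have ntP : P :!=: 1 by apply: contraNneq ncP => ->; rewrite cents1.
  by have [] := pgroup_pdiv (pHall_pgroup sylp) ntP.
have sylR : p.-Sylow(N) R.
  apply: subHall_Sylow hallR q'p _.
  by rewrite pHallE subxx /= part_pnat_id.
have irrR R1 : R1 \proper R -> Q \subset 'N(R1) -> Q \subset 'C(R1).
  move=> /andP[sR1 neR1] nR1; apply: contraR neR1 => nc.
  by have [-> _] := abRQ _ _ sR1 (subxx _) nR1 nc.
have coQR : coprime #|R| #|Q| := coRQ.
have TI_RQ := coprime_abel_cent_TI nRQ coQR abR.
(* [Q] centralises its proper invariant subgroups of [R]; if [[~: R, Q]] were proper it would lie in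
   ['C(Q)], whereas by coprime action it has no nontrivial fixed point. *)
have RQR : [~: R, Q] = R.
  have sRQ : [~: R, Q] \subset R by rewrite commg_subl.
  have nRQQ : Q \subset 'N([~: R, Q]) := commg_normr _ _.
  apply: contraNeq ncRQ => neq.
  have := irrR [~: R, Q]%G; rewrite properEneq sRQ neq => /(_ isT nRQQ) cQ.
  rewrite centsC; apply/commG1P; rewrite -TI_RQ.
  by apply/esym/setIidPl; rewrite centsC.
have CRQ : 'C_R(Q) = 1 by rewrite -{1}RQR.
exists p, q, R, Q; split; split => //.
- have /subsetPn[y Qy ncy] := ncRQ.
  have syQ : <[y]> \subset Q by rewrite cycle_subG.
  have [|_ <-] := abRQ _ _ (subxx R) syQ (subset_trans syQ nRQ).
    by rewrite cycle_subG.
  exact: cycle_cyclic.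
- move=> R1 prR1 nR1; apply/trivgP; rewrite -CRQ subsetI proper_sub //=.
  by rewrite centsC irrR.
Qed.

End ProperAbelian.

(** * Sylow subgroups of [S], their normalisers and centralisers *)

Section SylowStructure.
Variable gT : finGroupType.
Implicit Types G H K N P Q R : {group gT}.
Variable S : {group gT}.
Hypotheses (simS : simple S) (nabS : ~~ abelian S).
Hypothesis ab2S :
  forall H K : {group gT}, H \proper S -> K \proper H -> abelian K.

Lemma simple_nt : S :!=: 1.
Proof. by apply: contraNneq nabS => ->; rewrite abelian1. Qed.

Lemma simple_not_sol : ~~ solvable S.
Proof.
apply: contra nabS => solS.
exact/cyclic_abelian/prime_cyclic/simple_sol_prime.
Qed.

Lemma simple_normP H : H <| S -> H :!=: 1 -> H :=: S.
Proof. by case/simpleP: simS => _ h /h[->|//]; rewrite eqxx. Qed.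

Lemma norm_proper H : H :!=: 1 -> H \proper S -> 'N_S(H) \proper S.
Proof.
move=> ntH /andP[sHS nS]; rewrite properEneq subsetIl andbT.
apply: contraNneq nS => E; rewrite (simple_normP _ ntH) //.
by rewrite /normal sHS -E subsetIr.
Qed.

Lemma simple_center : 'Z(S) = 1.
Proof.
apply: contraNeq nabS => /(simple_normP (center_normal S)) E.
exact/center_idP.
Qed.

Lemma cent_proper H : H :!=: 1 -> H \subset S -> 'C_S(H) \proper S.
Proof.
move=> ntH sHS; rewrite properEneq subsetIl andbT.
apply: contraNneq ntH => E; rewrite -subG1 -simple_center subsetI sHS.
by rewrite centsC -E subsetIr.
Qed.

Lemma Sylow_proper p P : p.-Sylow(S) P -> P \proper S.
Proof.
move=> sylP; rewrite properEneq (pHall_sub sylP) andbT.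
apply: contraNneq simple_not_sol => <-; exact: pgroup_sol (pHall_pgroup sylP).
Qed.

(* A nonabelian Sylow subgroup P is a maximal subgroup.  A
   maximal nontrivial intersection D of P with a conjugate has a normaliser
   which is minimal nonabelian but not a p-group, and the comparison of D with
   Z(P) inside a cyclic Sylow subgroup of it is contradictory.  So P is TI and
   self-normalising, and the Frobenius kernel is a normal complement. *)
Lemma Sylow_abelian p P : p.-Sylow(S) P -> abelian P.
Proof.
move=> sylP; apply: wlog_neg => nabP.
have sPS := pHall_sub sylP; have pP := pHall_pgroup sylP.
have prP := Sylow_proper sylP.
have ntP : P :!=: 1 by apply: contraNneq nabP => ->; rewrite abelian1.
have maxP (X : {group gT}) : P \subset X -> X \proper S -> X :=: P.
  move=> sPX prX; apply/eqP; rewrite eq_sym; apply: contraNT nabP => neq.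
  by apply: (ab2S prX); rewrite properEneq neq.
have NP : 'N_S(P) = P.
  by apply: maxP; rewrite ?norm_proper // subsetI sPS normG.
pose Z := 'Z(P)%G.
have ntZ : Z :!=: 1 by apply: contraNneq ntP => /(trivg_center_pgroup pP) ->.
have sZP : Z \subset P := center_sub P.
have CZ : 'C_S(Z) = P.
  apply: maxP; last by rewrite cent_proper // (subset_trans sZP).
  by rewrite subsetI sPS centsC subsetIr.
have TI g : g \in S -> P :&: P :^ g != 1 -> P :^ g = P.
  move=> Sg; have [//|neq ntPg] := eqVneq (P :^ g) P.
  pose A g := (g \in S) && (P :^ g != P).
  have Ag : A g by rewrite /A Sg.
  case: (@arg_maxnP _ g A (fun h => #|P :&: P :^ h|) Ag) => h /andP[Sh neqh] maxh.
  pose D := (P :&: P :^ h)%G.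
  have ntD : D :!=: 1.
    rewrite -cardG_gt1; apply: leq_trans (maxh g Ag); by rewrite cardG_gt1.
  have sDP : D \subset P := subsetIl _ _.
  have pD : p.-group D := pgroupS sDP pP.
  have Dmax (R : {group gT}) : p.-Sylow(S) R -> #|D| < #|P :&: R| -> R :=: P.
    move=> sylR; have [k Sk ->] := Sylow_trans sylP sylR.
    move=> lt; apply/eqP; apply: contraTT lt => nk; rewrite -leqNgt.
    by apply: maxh; rewrite /A Sk.
  have prD : D \proper S := sub_proper_trans sDP prP.
  pose N := 'N_S(D)%G; have prN : N \proper S := norm_proper ntD prD.
  have prDP : D \proper P.
    rewrite properEneq sDP andbT; apply: contraNneq neqh => /setIidPl sP.
    by rewrite eq_sym eqEcard sP cardJg /=.
  have prDPh : D \proper P :^ h.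
    rewrite properEneq subsetIr andbT; apply: contraNneq neqh => /setIidPr sP.
    by rewrite eqEcard sP cardJg /=.
  pose T0 := 'N_P(D)%G.
  have prT0 : D \proper T0 by apply: nilpotent_proper_norm (pgroup_nil pP) prDP.
  have sT0N : T0 \subset N by rewrite setSI.
  have pT0 : p.-group T0 by apply: pgroupS pP; apply: subsetIl.
  have [T sylT sT0T] := Sylow_superset sT0N pT0.
  have pT := pHall_pgroup sylT; have sTN := pHall_sub sylT.
  have sTS : T \subset S := subset_trans sTN (proper_sub prN).
  have [R sylR sTR] := Sylow_superset sTS pT.
  have RP : R :=: P.
    apply: Dmax => //; apply: leq_trans (proper_card prT0) _.
    by rewrite subset_leq_card // subsetI subsetIl (subset_trans sT0T).
  have sTP : T \subset P by rewrite -RP.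
  (* Otherwise [T] contains the normaliser of [D] in [P :^ h]; since [T] lies in [P], that
     normaliser is inside [D], although it is strictly larger. *)
  have nnT : ~~ (N \subset 'N(T)).
    apply/negP => nTN; have pPh : p.-group (P :^ h) by rewrite pgroupJ.
    pose T1 := 'N_(P :^ h)(D)%G.
    have prT1 : D \proper T1.
      by apply: nilpotent_proper_norm (pgroup_nil pPh) prDPh.
    have sT1N : T1 \subset N by rewrite setSI // conj_subG.
    have pT1 : p.-group T1 by apply: pgroupS pPh; apply: subsetIl.
    have [n Nn sT1] := Sylow_subJ sylT sT1N pT1.
    rewrite (normsP nTN) // in sT1.
    case/negP: (proper_subn prT1); rewrite subsetI (subset_trans sT1 sTP).
    by rewrite subsetIl.
  have nabN : ~~ abelian N.
    by apply: contra nnT => abN; apply: sub_abelian_norm.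
  have notpN : ~~ p.-group N.
    apply: contra nnT => pN.
    by rewrite (sub_pHall sylT pN sTN (subxx N)) normG.
  have sDN : D \subset N by rewrite subsetI (proper_sub prD) normG.
  have [pp pdD _] := pgroup_pdiv pD ntD.
  have pdN : p %| #|N| := dvdn_trans pdD (cardSg sDN).
  have [[r rN]|] := proper_abelian_cases nabN (fun K => ab2S prN).
    case/negP: notpN; have /pgroupP/(_ p pp pdN) := rN.
    by rewrite !inE => /eqP->.
  case=> r [q [R' [Q [[pr pq neq_rq sylR' sylQ] [defN abR cycQ ncRQ irr]]]]].
  have [nR sQN _ nRQ _] := sdprod_context defN.
  have : (p == r) || (p == q).
    move: pdN; rewrite -(sdprod_card defN) Euclid_dvdM //.
    case/orP=> pd; [have /pgroupP/(_ p pp pd) := pHall_pgroup sylR'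
                   |have /pgroupP/(_ p pp pd) := pHall_pgroup sylQ];
    by rewrite !inE => /eqP->; rewrite eqxx ?orbT.
  case/orP=> /eqP E.
    rewrite E in sylT; have [n Nn TR] := Sylow_trans sylR' sylT.
    case/negP: nnT; rewrite TR (normsP (normal_norm nR)) //.
    exact: normal_norm.
  rewrite -E in sylQ neq_rq.
  have cycT : cyclic T.
    by have [n _ ->] := Sylow_trans sylQ sylT; rewrite cyclicJ.
  have sDT : D \subset T := subset_trans (proper_sub prT0) sT0T.
  have sZT : Z \subset T.
    apply: subset_trans sT0T; rewrite subsetI sZP cents_norm //.
    by rewrite centsC (subset_trans sDP) // centsC subsetIr.
  have : (D \subset Z) || (Z \subset D).
    rewrite -(cardSg_cyclic cycT sDT sZT) -(cardSg_cyclic cycT sZT sDT) (card_pgroup pD).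
    by rewrite (card_pgroup (pgroupS sZP pP)) !dvdn_Pexp2l ?prime_gt1 // leq_total.
  (* If [D] is in [Z], then [P] lies in [N], so [N = P] by maximality. If [Z] is in [D], then [R'],
     which centralises [D], lies in ['C_S(Z) = P] and is trivial by coprimality. *)
  case/orP=> sDZ.
    case/negP: notpN; rewrite (maxP N) // subsetI sPS cents_norm //.
    by rewrite centsC (subset_trans sDZ) ?subsetIr.
  have coRD : coprime #|R'| #|D|.
    apply: pnat_coprime (pHall_pgroup sylR') _; apply: sub_in_pnat pD => x _.
    by rewrite !inE => /eqP->; rewrite eq_sym.
  have cRD : R' \subset 'C(D).
    apply/commG1P/trivgP; rewrite -(coprime_TIg coRD) subsetI.
    rewrite commg_subl commg_subr; apply/andP; split.
      exact: subset_trans sDN (normal_norm nR).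
    exact: subset_trans (normal_sub nR) (subsetIr _ _).
  case/negP: ncRQ; rewrite (_ : gval R' = 1) ?cents1 //.
  have sRP : R' \subset P.
    rewrite -CZ; apply/subsetIP; split; last exact: subset_trans (centS sDZ).
    exact: subset_trans (normal_sub nR) (proper_sub prN).
  rewrite -(setIidPl sRP); apply: coprime_TIg.
  apply: pnat_coprime (pHall_pgroup sylR') _; apply: sub_in_pnat pP => x _.
  by rewrite !inE => /eqP->; rewrite eq_sym.
have frobS : [Frobenius S with complement P].
  rewrite /Frobenius_group_with_complement (proper_neq prP).
  apply/normedTI_P; rewrite setD_eq0 subG1 ntP subsetI sPS normD1 normG.
  split=> // g Sg /pred0Pn[x /= /andP[/setD1P[ntx Px]]].
  rewrite conjD1g => /setD1P[_ Pgx]; rewrite -NP inE Sg /=; apply/normP.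
  by apply: TI => //; apply/trivgPn; exists x; rewrite // inE Px.
have [K /andP[/eqP defS _]] := Frobenius_kernel_exists frobS.
have [nK _ mulKP _ tiKP] := sdprod_context defS.
have [K1|ntK] := eqVneq (gval K) 1.
  by have := proper_neq prP; rewrite -defS K1 sdprod1g eqxx.
case/negP: ntP; rewrite -subG1 -tiKP (simple_normP nK) // subsetI sPS subxx //.
Qed.

(** ['N_S(P)] is nonabelian by transfer and not a [p]-group, so it splits as in
    [proper_abelian_cases]. There [P] cannot be the cyclic factor: being normal, it would centralise
    the other one. *)
Let Sylow_norm_cases p P : p.-Sylow(S) P -> P :!=: 1 -> exists q Q,
  [/\ prime p, prime q, p != q & q.-group Q] /\
  [/\ P ><| Q = 'N_S(P), cyclic Q, ~~ (Q \subset 'C(P))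
   & forall R, R \proper P -> Q \subset 'N(R) -> R :=: 1].
Proof.
move=> sylP ntP; have abP := Sylow_abelian sylP; have pP := pHall_pgroup sylP.
have prN : 'N_S(P) \proper S := norm_proper ntP (Sylow_proper sylP).
have sPN : P \subset 'N_S(P) by rewrite subsetI (pHall_sub sylP) normG.
have nPN : P <| 'N_S(P) by rewrite /normal sPN subsetIr.
have nabN : ~~ abelian 'N_S(P).
  apply: contra (simple_Sylow_norm_cent simS nabS sylP ntP abP).
  by move=> abN; apply: subset_trans abN (centS sPN).
have sylPN : p.-Sylow('N_S(P)) P by rewrite Sylow_subnorm.
have [pp pdP _] := pgroup_pdiv pP ntP.
have pdN : p %| #|'N_S(P)| := dvdn_trans pdP (cardSg sPN).
have [[r rN]|] := proper_abelian_cases nabN (fun K => ab2S prN).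
  have /pgroupP/(_ p pp pdN) := rN; rewrite !inE => /eqP E.
  rewrite -E in rN; have NP := sub_pHall sylPN rN sPN (subxx _).
  by case/negP: nabN; rewrite NP.
case=> r [q [R [Q [[pr pq neq_rq sylR sylQ] [defN abR cycQ ncRQ irr]]]]].
have [nR sQN _ nRQ tiRQ] := sdprod_context defN.
have : (p == r) || (p == q).
  move: pdN; rewrite -(sdprod_card defN) Euclid_dvdM //.
  case/orP=> pd; [have /pgroupP/(_ p pp pd) := pHall_pgroup sylR
                 |have /pgroupP/(_ p pp pd) := pHall_pgroup sylQ];
  by rewrite !inE => /eqP->; rewrite eqxx ?orbT.
case/orP=> /eqP E; rewrite -E in neq_rq.
  rewrite -E in sylR; have [n Nn RP] := Sylow_trans sylPN sylR.
  have ER : R = P.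
    apply: val_inj; rewrite /= RP (normsP (normal_norm nPN)) //.
  rewrite ER in defN ncRQ irr; exists q, Q; split; split=> //.
  exact: pHall_pgroup sylQ.
rewrite -E in sylQ; have [n Nn QP] := Sylow_trans sylPN sylQ.
case/negP: ncRQ; apply/commG1P/trivgP; rewrite -tiRQ setIC subsetI.
rewrite commg_subl commg_subr nRQ andbT.
by rewrite QP (normsP (normal_norm nPN)) // (subset_trans (normal_sub nR)) ?subsetIr.
Qed.

Lemma Sylow_abelem p P : p.-Sylow(S) P -> P :!=: 1 -> p.-abelem P.
Proof.
move=> sylP ntP; have pP := pHall_pgroup sylP.
have [q [Q [_ [/sdprod_context[_ _ _ nPQ _] _ _ irr]]]] := Sylow_norm_cases sylP ntP.
have sub : 'Ohm_1(P) \subset P := Ohm_sub 1 P.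
have [eqP1|neq] := eqVneq 'Ohm_1(P) P.
  by rewrite -eqP1 Ohm1_abelem ?(Sylow_abelian sylP).
have := irr 'Ohm_1(P)%G; rewrite properEneq neq sub.
rewrite (char_norm_trans (Ohm_char 1 P) nPQ) => /(_ isT isT)/eqP.
by rewrite Ohm1_eq1 (negPf ntP).
Qed.

(** The cyclic complement lies in an elementary abelian Sylow subgroup, so its order is prime;
    irreducibility makes its fixed points in [P] trivial. *)
Lemma Sylow_norm_struct p P : p.-Sylow(S) P -> P :!=: 1 -> exists q Q,
  [/\ prime p, prime q, p != q & #|Q| = q] /\
  [/\ [Frobenius 'N_S(P) = P ><| Q]
   & forall R, R \proper P -> Q \subset 'N(R) -> R :=: 1].
Proof.
move=> sylP ntP.
have [q [Q [[pp pq npq qQ] [defN cycQ ncQ irr]]]] := Sylow_norm_cases sylP ntP.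
have [nP sQN _ nPQ _] := sdprod_context defN.
have ntQ : Q :!=: 1 by apply: contraNneq ncQ => ->; rewrite sub1G.
have sQS : Q \subset S := subset_trans sQN (subsetIl _ _).
have [Q1 sylQ1 sQ1] := Sylow_superset sQS qQ.
have ntQ1 : Q1 :!=: 1 by apply: contraNneq ntQ => E; rewrite -subG1 -E.
have abelQ : q.-abelem Q := abelemS sQ1 (Sylow_abelem sylQ1 ntQ1).
have oQ := cyclic_abelem_prime abelQ cycQ ntQ.
exists q, Q; split; split => //; apply/prime_FrobeniusP; rewrite ?oQ //.
split=> //; have [E|neq] := eqVneq 'C_P(Q) P.
  by case/negP: ncQ; rewrite centsC -E subsetIr.
apply: (irr 'C_P(Q)%G); first by rewrite properEneq neq subsetIl.
by rewrite normsI // cents_norm // centsC.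
Qed.

(** ['C_S[x]] contains [P]. If it is abelian, it normalises [P], and the Frobenius kernel contains
    the centralisers of its elements. If it is some [R ><| T] as in [proper_abelian_cases], the
    central element [x] is a nontrivial fixed point of [T] in [R], or it generates [T]; either way
    [T] centralises [R]. *)
Lemma Sylow_cent1 p P x : p.-Sylow(S) P -> x \in P^# -> 'C_S[x] = P.
Proof.
move=> sylP /setD1P[ntx Px].
have ntP : P :!=: 1 by apply/trivgPn; exists x.
have [q [Q [[pp pq npq oQ] [frobN irr]]]] := Sylow_norm_struct sylP ntP.
have sPS := pHall_sub sylP; have pP := pHall_pgroup sylP.
have abP := Sylow_abelian sylP.
have sPC : P \subset 'C_S[x].
  by rewrite subsetI sPS -cent_set1 centsC sub1set (subsetP abP).
have prC : 'C_S[x] \proper S.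
  rewrite -cent_cycle; apply: (@cent_proper <[x]>%G); first by rewrite cycle_eq1.
  by rewrite cycle_subG (subsetP sPS).
have px : p.-elt x := mem_p_elt pP Px.
have [abC|nabC] := boolP (abelian 'C_S[x]).
  apply/eqP; rewrite eqEsubset sPC andbT.
  have /Frobenius_cent1_ker/(_ x) := frobN; rewrite !inE ntx Px => /(_ isT).
  apply: subset_trans; rewrite !subsetI subsetIl subsetIr andbT /=.
  by rewrite cents_norm // (sub_abelian_cent2 abC).
have Cx : x \in 'C_S[x] := subsetP sPC x Px.
have sylPC : p.-Sylow('C_S[x]) P := pHall_subl sPC (subsetIl _ _) sylP.
have [pp' pdP _] := pgroup_pdiv pP ntP.
have pdC : p %| #|'C_S[x]| := dvdn_trans pdP (cardSg sPC).
have [[r rN]|] := proper_abelian_cases nabC (fun K => ab2S prC).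
  have /pgroupP/(_ p pp pdC) := rN; rewrite !inE => /eqP E.
  rewrite -E in rN; exact: sub_pHall sylPC rN sPC (subxx _).
case=> r [t [R [T [[pr pt neq sylR sylT] [defC abR cycT ncRT irrR]]]]].
have [nR sTC _ nRT _] := sdprod_context defC.
case/negP: ncRT.
have cx (A : {group gT}) : A \subset 'C_S[x] -> x \in 'C(A).
  move=> sA; rewrite -sub1set centsC cent_set1.
  exact: subset_trans sA (subsetIr _ _).
have [E|[E pdT]] : p = r \/ (p = t /\ p %| #|T|).
  move: pdC; rewrite -(sdprod_card defC) Euclid_dvdM // => /orP[] pd.
    by have /pgroupP/(_ p pp pd) := pHall_pgroup sylR; rewrite !inE => /eqP; left.
  by have /pgroupP/(_ p pp pd) := pHall_pgroup sylT; rewrite !inE => /eqP; right.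
- rewrite -E in sylR; have Rx : x \in R by rewrite (mem_normal_Hall sylR nR).
  have [EC|neC] := eqVneq 'C_R(T) R; first by rewrite centsC -EC subsetIr.
  have := irrR 'C_R(T)%G; rewrite properEneq neC subsetIl => /(_ isT) E1.
  have : x \in 'C_R(T) by rewrite inE Rx cx.
  rewrite /= E1; first by rewrite inE (negPf ntx).
  by rewrite normsI // cents_norm // centsC.
rewrite -E in sylT; have pT := pHall_pgroup sylT.
have [T1 sylT1 sT1] := Sylow_superset (subset_trans sTC (subsetIl _ _)) pT.
have ntT : T :!=: 1.
  by rewrite -cardG_gt1 (leq_trans _ (dvdn_leq _ pdT)) ?prime_gt1.
have abelT : p.-abelem T.
  apply: (abelemS sT1 (Sylow_abelem sylT1 _)).
  by apply: contraNneq ntT => E1; rewrite -subG1 -E1.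
have oT := cyclic_abelem_prime abelT cycT ntT.
have sxC : <[x]> \subset 'C_S[x] by rewrite cycle_subG.
have [y Cy sxT] := Sylow_subJ sylT sxC px.
have Tx : x \in T.
  have : x ^ y^-1 \in T by rewrite -mem_conjg -cycle_subG.
  suff -> : x ^ y^-1 = x by [].
  apply/conjg_fixP/commgP; move: Cy; rewrite -groupV inE => /andP[_ /cent1P].
  exact.
have sTx : T \subset <[x]>.
  apply: prime_meetG; rewrite ?oT //; apply/trivgPn; exists x => //.
  by rewrite inE Tx cycle_id.
by apply: subset_trans sTx _; rewrite cycle_subG cx ?(normal_sub nR).
Qed.
End SylowStructure.

(** * The elements of [S] sorted by primes *)

Section SylowChoice.
Variables (gT : finGroupType) (S : {group gT}).
Definition syl p : {group gT} := sval (Sylow_exists p S).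
Lemma sylP p : p.-Sylow(S) (syl p). Proof. by rewrite /syl; case: Sylow_exists. Qed.
Definition sylN p := 'N_S(syl p)%G.
Definition sylI p := #|sylN p : syl p|.
End SylowChoice.

Section SylowPartition.
Variables (gT : finGroupType) (S : {group gT}).
Implicit Types G H K N P Q R : {group gT}.
Hypotheses (simS : simple S) (nabS : ~~ abelian S).
Hypothesis ab2S :
  forall H K : {group gT}, H \proper S -> K \proper H -> abelian K.
Local Notation syl := (syl S).
Local Notation sylN := (sylN S).
Local Notation sylI := (sylI S).
Local Notation sylP := (sylP S).

Lemma syl_nt p : p \in \pi(S) -> syl p :!=: 1.
Proof. by rewrite -cardG_gt1 (card_Hall (sylP p)) p_part_gt1. Qed.

Lemma sylN_proper p : p \in \pi(S) -> sylN p \proper S.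
Proof.
move=> pS; apply: (norm_proper simS (syl_nt pS)).
exact: Sylow_proper simS nabS _ _ (sylP p).
Qed.

Lemma sylN_frob p : p \in \pi(S) -> exists Q,
  [/\ #|Q| = sylI p, prime (sylI p), sylI p != p, sylI p \in \pi(S)
   & [Frobenius sylN p = syl p ><| Q]] /\
   (forall R, R \proper syl p -> Q \subset 'N(R) -> R :=: 1).
Proof.
move=> pS; have ntP := syl_nt pS.
have [q [Q [[pp pq npq oQ] [frobN irr]]]] :=
  Sylow_norm_struct simS nabS ab2S (sylP p) ntP.
have [defN _ _ _ _] := Frobenius_context frobN.
have [_ sQN _ _ _] := sdprod_context defN.
have lq : sylI p = q.
  by rewrite -oQ (index_sdprod defN).
exists Q; split => //; rewrite lq; split => //; first by rewrite eq_sym.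
rewrite mem_primes pq cardG_gt0 -oQ cardSg //.
exact: subset_trans sQN (subsetIl _ _).
Qed.

Lemma sylN_index p : p \in \pi(S) ->
  (#|S : sylN p| * (#|syl p| * sylI p) = #|S|)%N.
Proof.
move=> pS; have sPN : syl p \subset sylN p.
  by rewrite subsetI normG (pHall_sub (sylP p)).
by rewrite mulnC Lagrange // Lagrange // subsetIl.
Qed.

Lemma Sylow_normedTI p P : p.-Sylow(S) P -> P :!=: 1 -> normedTI P^# S 'N_S(P).
Proof.
move=> sylPP ntP; apply/normedTI_P; rewrite setD_eq0 subG1 ntP.
rewrite subsetI subsetIl normD1 subsetIr; split=> // g Sg /pred0Pn[x /= /andP[Px]].
rewrite conjD1g => Pgx; rewrite inE Sg /=; apply/normP.
have sylPg : p.-Sylow(S) (P :^ g)%G by rewrite pHallJ.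
by rewrite -(Sylow_cent1 simS nabS ab2S sylPg Pgx) (Sylow_cent1 simS nabS ab2S sylPP Px).
Qed.

(** A power [y] of [x] has prime order and lies in a Sylow subgroup [P]; [x] centralises [y], and
    ['C_S[y] = P]. In particular all orders are prime powers. *)
Lemma elt_in_Sylow x : x \in S^# ->
  exists p P, [/\ p \in \pi(S), p.-Sylow(S) P & x \in P^#].
Proof.
move=> /setD1P[ntx Sx]; pose p := pdiv #[x].
have pp : prime p by rewrite pdiv_prime // order_gt1.
have pdx : p %| #[x] := pdiv_dvd _.
have pS : p \in \pi(S).
  by rewrite mem_primes pp cardG_gt0 (dvdn_trans pdx) ?order_dvdG.
pose y := x ^+ (#[x] %/ p).
have oy : #[y] = p.
  by rewrite orderXdiv ?dvdn_div // divnA // mulKn ?order_gt0.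
have Sy : <[y]> \subset S by rewrite cycle_subG groupX.
have py : p.-group <[y]> by rewrite /pgroup -orderE oy pnat_id.
have [P sylPP sP] := Sylow_superset Sy py.
exists p, P; split=> //; apply/setD1P; split=> //.
rewrite -(@Sylow_cent1 _ _ simS nabS ab2S _ _ y sylPP).
  by rewrite inE Sx /=; apply/cent1P; apply: commuteX.
by rewrite !inE -cycle_subG sP -order_gt1 oy prime_gt1.
Qed.

Lemma class_support_syl p : p \in \pi(S) ->
  class_support (syl p)^# S = [set x in S^# | p.-elt x].
Proof.
move=> pS; apply/setP=> x; rewrite inE; apply/imset2P/andP => [|[/setD1P[ntx Sx] px]].
  case=> y g /setD1P[nty Py] Sg ->; rewrite !inE conjg_eq1 nty p_eltJ.
  split; first by rewrite /= groupJ // (subsetP (pHall_sub (sylP p)) y Py).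
  exact: mem_p_elt (pHall_pgroup (sylP p)) Py.
have sxS : <[x]> \subset S by rewrite cycle_subG.
have [g Sg sx] := Sylow_subJ (sylP p) sxS px.
exists (x ^ g^-1) g; rewrite ?conjgKV //.
by rewrite !inE conjg_eq1 ntx -mem_conjg -cycle_subG.
Qed.

Lemma card_elts p : p \in \pi(S) ->
  #|[set x in S^# | p.-elt x]| = (#|syl p|.-1 * #|S : sylN p|)%N.
Proof.
move=> pS; rewrite -class_support_syl //.
rewrite (card_support_normedTI (Sylow_normedTI (sylP p) (syl_nt pS))).
by rewrite (cardsD1 1 (syl p)) group1.
Qed.

(** Stated for any commutative law, since it serves both to count elements and to sum squared moduli
    of character values. *)
Lemma big_elts (R : Type) (idx : R) (op : Monoid.com_law idx) (F : gT -> R) :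
  \big[op/idx]_(x in S^#) F x =
  \big[op/idx]_(p <- primes #|S|) \big[op/idx]_(x in [set x in S^# | p.-elt x]) F x.
Proof.
under [RHS]eq_bigr => p _ do rewrite big_mkcond.
rewrite exchange_big /= big_mkcond; apply: eq_bigr => x _.
case: ifPn => Sx; last by rewrite big1 // => p _; rewrite inE (negPf Sx).
have [p [P [pS sylPP Px]]] := elt_in_Sylow Sx.
have [/setD1P[ntx Px'] pP] := (Px, pHall_pgroup sylPP).
have px : p.-elt x := mem_p_elt pP Px'.
rewrite (big_rem p) //= inE Sx px /= [X in op _ X]big1_seq ?Monoid.mulm1 //.
move=> r /=; rewrite mem_rem_uniq ?primes_uniq // inE => /andP[neq rS].
rewrite inE Sx /= ifN //; apply: contra ntx => rx; rewrite -order_eq1.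
move: rS; rewrite mem_primes => /andP[pr _].
have := pnat_coprime px (_ : p^'.-nat #[x]).
rewrite /coprime gcdnn; apply; apply: sub_in_pnat rx => y _.
by rewrite !inE => /eqP->.
Qed.

Lemma card_partition :
  #|S| = (1 + \sum_(p <- primes #|S|) #|syl p|.-1 * #|S : sylN p|)%N.
Proof.
rewrite {1}(cardsD1 1 S) group1; congr (_ + _)%N.
rewrite -sum1_card big_elts. apply: eq_big_seq => p pS.
by rewrite sum1_card card_elts.
Qed.

End SylowPartition.

End AbelianSecondMaximal.

(** * Even order *)

(** The count of involutions with a single dihedral prime [p]. As [q] divides [p.-1], [p] exceeds
    [q]; then [p] divides [2 * m = q.+1 * p + q.-1], hence [q.-1]. *)
Lemma even_arith1 q m p : prime q -> odd q -> prime p -> odd p ->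
  (2 * m = 2 * q + q.+1 * p.-1)%N -> q %| m -> p %| q.+1 * m -> False.
Proof.
move=> pq oq pp op E qm pg.
have [p0 q1] := (prime_gt1 pp, prime_gt1 pq).
have qp : q %| p.-1.
  have : q %| q.+1 * p.-1.
    by rewrite -(dvdn_addr (m := 2 * q)) ?dvdn_mull // -E dvdn_mull.
  by rewrite Gauss_dvdr // coprimenS.
have ltqp : q < p by have := dvdn_leq _ qp; lia.
have p2 : p %| 2 * m.
  move: pg; rewrite Euclid_dvdM // => /orP[pq1|]; last exact: dvdn_mull.
  have := dvdn_leq _ pq1; rewrite ltn0Sn => /(_ isT) le.
  have Ep : p = q.+1 by lia.
  by move: op; rewrite Ep /= oq.
have : p %| q.-1.
  have : p %| q.+1 * p by rewrite dvdn_mull.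
  have Eqp : (q.+1 * p.-1 = q.+1 * p - q.+1)%N by rewrite -subn1 mulnBr muln1.
  have le : (q.+1 <= q.+1 * p)%N by rewrite leq_pmulr // ltnW.
  rewrite {}Eqp in E.
  have <- : (2 * m - q.+1 * p = q.-1)%N by clear -E le q1 p0; lia.
  exact: dvdn_sub.
by move/dvdn_leq; lia.
Qed.

(** The count with two dihedral primes, one of them being [q] itself and the other [r]. *)
Lemma pow2_arith q a r : prime q -> odd q -> prime r -> odd r -> r != q ->
  q.+1 = (2 ^ a)%N -> q %| q + r - 2 -> r %| q.+1 * q - 2 -> q = 3 /\ r = 5.
Proof.
move=> pq oq pr or neq E /dvdnP[k Ek] rd.
have [q1 r1] := (prime_gt1 pq, prime_gt1 pr).
have q3 : 2 < q by rewrite odd_prime_gt2.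
have r3 : 2 < r by rewrite odd_prime_gt2.
have k2 : 2 <= k by clear -Ek q3 r3; nia.
have rq2 : q + 2 <= r by clear -Ek k2 q3; nia.
have : r %| (q + 2) * q.-1 by rewrite (_ : _ * _ = q.+1 * q - 2)%N //; case: (q) q1 => // q' _; lia.
rewrite Euclid_dvdM // => /orP[] /dvdn_leq; last by lia.
move=> /(_ ltac:(lia)) le; have Er : r = q + 2 by lia.
suff q3' : q = 3 by rewrite Er q3'.
(* These are three consecutive numbers, and the middle one is a power of 2. *)
have d3 : 3 %| q * (q.+1 * r).
  rewrite Er; have := divn_eq q 3; have := ltn_pmod q (isT : 0 < 3).
  set u := q %/ 3; case: (q %% 3) => [|[|[|//]]] _ ->.
  - by rewrite addn0; apply/dvdn_mulr/dvdn_mull.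
  - apply/dvdn_mull/dvdn_mull; have -> : (u * 3 + 1 + 2 = u.+1 * 3)%N by lia.
    exact: dvdn_mull.
  - apply/dvdn_mull/dvdn_mulr; have -> : ((u * 3 + 2).+1 = u.+1 * 3)%N by lia.
    exact: dvdn_mull.
move: d3; rewrite !Euclid_dvdM // => /or3P[||].
- by rewrite dvdn_prime2 // => /eqP.
- by rewrite E Euclid_dvdX // => /andP[].
- by rewrite dvdn_prime2 // => /eqP; lia.
Qed.

(** The count with two dihedral primes. If both differ from [q], put [k * q = p + r - 2]: then [p]
    and [r] divide [k * q + k + 2 = p + r + k], so [p * r <= p + r + k], which is too small. *)
Lemma even_arith2 q m p r a : prime q -> odd q -> prime p -> odd p ->
  prime r -> odd r -> p != r -> q.+1 = (2 ^ a)%N ->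
  (2 * m = 2 * q + q.+1 * (p.-1 + r.-1))%N -> q %| m ->
  p %| q.+1 * m -> r %| q.+1 * m -> q = 3 /\ m = 15.
Proof.
move=> pq oq pp op pr or neq E Em qm pg rg.
have [[q1 p1] r1] := (prime_gt1 pq, prime_gt1 pp, prime_gt1 pr).
have q3 : 2 < q by rewrite odd_prime_gt2.
have p3 : 2 < p by rewrite odd_prime_gt2.
have r3 : 2 < r by rewrite odd_prime_gt2.
have dm x : prime x -> odd x -> x %| q.+1 * m -> x %| 2 * m.
  move=> px ox; rewrite E Euclid_dvdM // Euclid_dvdX // => /orP[/andP[]|].
    by rewrite dvdn_prime2 // => /eqP xE; rewrite xE in ox.
  exact: dvdn_mull.
have rm := dm r pr or rg; have {dm}pm := dm p pp op pg.
have pr2 : (p.-1 + r.-1 = p + r - 2)%N by clear -p1 r1; lia.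
rewrite pr2 in Em.
have qk : q %| p + r - 2.
  have : q %| q.+1 * (p + r - 2).
    by rewrite -(dvdn_addr (m := 2 * q)) ?dvdn_mull // -Em dvdn_mull.
  by rewrite Gauss_dvdr ?coprimenS.
have Er : (q.+1 * (p + r - 2) + q.+1 * 2 = q.+1 * p + q.+1 * r)%N.
  by rewrite -!mulnDr subnK //; clear -p1 r1; lia.
have lep : (q.+1 <= q.+1 * p)%N by rewrite leq_pmulr // ltnW.
have ler : (q.+1 <= q.+1 * r)%N by rewrite leq_pmulr // ltnW.
have pd : p %| q.+1 * r - 2.
  have -> : (q.+1 * r - 2 = 2 * m - q.+1 * p)%N by clear -Em Er lep ler; lia.
  by rewrite dvdn_sub // dvdn_mull.
have rd : r %| q.+1 * p - 2.
  have -> : (q.+1 * p - 2 = 2 * m - q.+1 * r)%N by clear -Em Er lep ler; lia.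
  by rewrite dvdn_sub // dvdn_mull.
have [Epq|npq] := eqVneq p q.
  subst p; have [||| q3' r5] := pow2_arith pq oq pr or _ E => //; first by rewrite eq_sym.
  by split=> //; move: Em; subst q r; clear; lia.
have [Erq|nrq] := eqVneq r q.
  subst r; have [|| q3' p5] := pow2_arith pq oq pp op npq E => //; first by rewrite addnC.
  by split=> //; move: Em; subst q p; clear; lia.
have /dvdnP[k Ek] := qk.
have Ek' : (p + r = k * q + 2)%N by clear -Ek p1 r1; lia.
have k1 : 0 < k by case: (k) Ek' => //; clear -p3 r3; lia.
have Erk : (q.+1 * p + q.+1 * r = q.+1 * (k * q + 2))%N by rewrite -mulnDr Ek'.
have pd' : p %| k * q + k + 2.
  have : p %| q * (k * q + k + 2).
    have -> : (q * (k * q + k + 2) = q.+1 * r - 2 + q.+1 * p)%N.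
      by clear -Erk ler q1; lia.
    by rewrite dvdn_add // dvdn_mull.
  by rewrite Euclid_dvdM // dvdn_prime2 // (negPf npq).
have rd' : r %| k * q + k + 2.
  have : r %| q * (k * q + k + 2).
    have -> : (q * (k * q + k + 2) = q.+1 * p - 2 + q.+1 * r)%N.
      by clear -Erk lep q1; lia.
    by rewrite dvdn_add // dvdn_mull.
  by rewrite Euclid_dvdM // dvdn_prime2 // (negPf nrq).
have : p * r %| k * q + k + 2.
  by rewrite Gauss_dvd ?pd' // prime_coprime // dvdn_prime2.
move/dvdn_leq => /(_ ltac:(by rewrite addn2)) le.
have qk3 : (3 * k <= k * q)%N by rewrite mulnC leq_mul2l q3 orbT.
(* With [3 * k <= p + r - 2], the bound on [p * r] reads [(3 * p - 4) * (3 * r - 4) <= 10], whereas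
   both factors are at least 5. *)
have lp : (5 * (3 * r - 4) <= (3 * p - 4) * (3 * r - 4))%N.
  by rewrite leq_mul2r; clear -p3; lia.
by clear -le qk3 Ek' p3 r3 lp; nia.
Qed.

Section EvenOrder.
Import GroupScope.

Section Even.
Variables (gT : finGroupType) (S : {group gT}).
Implicit Types G H K N P Q R : {group gT}.
Hypotheses (simS : simple S) (nabS : ~~ abelian S).
Hypothesis ab2S :
  forall H K : {group gT}, H \proper S -> K \proper H -> abelian K.
Local Notation syl := (syl S).
Local Notation sylN := (sylN S).
Local Notation sylI := (sylI S).
Local Notation sylP := (sylP S).

Definition involutions := [set t in S | #[t] == 2].
Local Notation I := involutions.

Let cent1S p P x : p.-Sylow(S) P -> x \in P^# -> 'C_S[x] = P.
Proof. exact: Sylow_cent1. Qed.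

Let syl_trans p R : p.-Sylow(S) R -> exists2 g, g \in S & R = (syl p :^ g)%G.
Proof.
by move=> sR; have [g Sg E] := Sylow_trans (sylP p) sR; exists g => //; apply: val_inj.
Qed.

Lemma involP t : reflect [/\ t \in S, t * t = 1 & t != 1] (t \in I).
Proof.
rewrite inE; apply: (iffP andP) => [[St /eqP ot]|[St tt nt]]; split=> //.
- by rewrite -(expgS t 1) -ot expg_order.
- by rewrite -order_gt1 ot.
by apply/eqP/nt_prime_order; rewrite // expgS expg1.
Qed.

Lemma norm_index p R : p.-Sylow(S) R -> #|'N_S(R) : R| = sylI p.
Proof.
move=> /syl_trans[g Sg ->].
rewrite -[RHS]/#|'N_S(syl p) : syl p| /=.
by rewrite normJ -{1}(conjGid Sg) -conjIg indexJg.
Qed.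

Lemma norm_sqr p R u : p.-Sylow(S) R -> sylI p = 2 ->
  u \in 'N_S(R) -> u \notin R -> u \in I.
Proof.
move=> sylR l2 Nu nRu; have [Su nu] := setIP Nu.
have sRN : R \subset 'N_S(R) by rewrite subsetI (pHall_sub sylR) normG.
have Ru2 : u * u \in R.
  have nRN : R <| 'N_S(R) by rewrite /normal sRN subsetIr.
  have : coset R u ^+ #|'N_S(R) / R| = 1 by rewrite expg_cardG // mem_quotient.
  rewrite card_quotient ?subsetIr // (norm_index sylR) l2 => E.
  apply: coset_idr; first by rewrite groupM.
  by rewrite morphM // -E expgS expg1.
apply/involP; split=> //; last by apply: contraNneq nRu => ->.
apply/eqP; apply: contraNT nRu => nt.
have Ru : u * u \in R^# by apply/setD1P.
rewrite -(cent1S sylR Ru); apply/setIP; split=> //; apply/cent1P.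
by rewrite /commute mulgA.
Qed.

(** [t] inverts [z], so it normalises ['C_S[z] = R]. *)
Lemma invol_norm p R z t : p.-Sylow(S) R -> p != 2 -> z \in R^# ->
  t \in I -> t * z \in I -> [/\ t \in 'N_S(R), t \notin R & sylI p = 2].
Proof.
move=> sylR np2 Rz /involP[St tt nt] /involP[_ tztz ntz].
have zt : z ^ t = z^-1.
  have tV : t^-1 = t by apply: (mulgI t); rewrite mulgV tt.
  rewrite mulgA in tztz; apply: (mulgI z); rewrite mulgV conjgE tV.
  by apply: (mulgI t); rewrite !mulgA tztz mul1g mulg1.
have [/setD1P[nz Rz'] pR] := (Rz, pHall_pgroup sylR).
have Nt : t \in 'N_S(R).
  rewrite inE St /=; apply/normP; rewrite -(cent1S sylR Rz) conjIg conjGid //.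
  by rewrite -cent1J zt -!cent_cycle cycleV.
have nRt : t \notin R.
  apply/negP => Rt; have := mem_p_elt pR Rt; rewrite /p_elt.
  have -> : #[t] = 2 by apply: nt_prime_order; rewrite // expgS expg1.
  by rewrite pnatE // inE eq_sym (negPf np2).
have pS : p \in \pi(S).
  have ntR : R :!=: 1 by apply/trivgPn; exists z.
  by rewrite -p_part_gt1 -(card_Hall sylR) cardG_gt1.
split=> //; have [Q [[_ pl _ _ _] _]] := sylN_frob simS nabS ab2S pS.
have : coset R t ^+ sylI p = 1.
  rewrite -(norm_index sylR) -card_quotient ?subsetIr //.
  by rewrite expg_cardG // mem_quotient.
have [_ nRt'] := setIP Nt.
have oRt : #[coset R t] = 2.
  apply: nt_prime_order => //; first by rewrite expgS expg1 -morphM // tt morph1.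
  by apply: contra nRt => /eqP/coset_idr; apply.
move/eqP; rewrite -order_dvdn oRt => d2.
by apply/esym/eqP; rewrite -dvdn_prime2.
Qed.

Hypothesis evS : 2 \in \pi(S).

(** An involution [t] of the normaliser inverts [P]: [y * y ^ t] commutes with [t], which lies
    outside [P], the centraliser of each nontrivial element of [P]. So all cyclic subgroups of [P]
    are invariant, and irreducibility makes [P] cyclic. *)
Lemma sylI2_order p R : p.-Sylow(S) R -> p \in \pi(S) -> sylI p = 2 -> #|R| = p.
Proof.
move=> /syl_trans[g Sg ->] pS l2; rewrite cardJg; have ntP := syl_nt pS.
have [Q [[oQ _ neq _ frobN] irr]] := sylN_frob simS nabS ab2S pS.
have [defN _ ntQ _ _] := Frobenius_context frobN.
have [_ sQN _ nPQ tiPQ] := sdprod_context defN.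
have [t Qt ntt] := trivgPn _ ntQ.
have defQ : Q :=: <[t]>.
  apply/eqP; rewrite eq_sym eqEcard cycle_subG Qt oQ l2 -orderE order_gt1 //.
have tt : t * t = 1 by rewrite -(expgS t 1) -l2 -oQ expg_cardG.
have [Nt [Pn Pt]] : t \in 'N_S(syl p) /\ t \in 'N(syl p) /\ t \notin syl p.
  split; first exact: (subsetP sQN); split; first exact: (subsetP nPQ).
  apply: contra ntt => Pt; rewrite -in_set1 -[[set 1]]tiPQ inE Pt Qt //.
have invt y : y \in syl p -> y ^ t = y^-1.
  move=> Py; have Pyt : y ^ t \in syl p by rewrite memJ_norm.
  apply: (mulgI y); rewrite mulgV; apply/eqP; apply: contraNT Pt => nt.
  have Pv : y * y ^ t \in (syl p)^# by apply/setD1P; rewrite nt groupM.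
  rewrite -(cent1S (sylP p) Pv); apply/setIP; split; first by have [] := setIP Nt.
  rewrite cent1C; apply/cent1P/commgP/conjg_fixP.
  rewrite conjMg -conjgM tt conjg1.
  by have /centsP := Sylow_abelian simS nabS ab2S (sylP p); apply.
have [y Py nty] := trivgPn _ ntP.
have defP : syl p :=: <[y]>.
  have [->//|neqy] := eqVneq <[y]> (gval (syl p)).
  have := irr <[y]>%G; rewrite properEneq neqy cycle_subG Py => /(_ isT).
  have -> : Q \subset 'N(<[y]>).
    rewrite defQ cycle_subG; apply/normP; rewrite -cycleJ invt //.
    by rewrite cycleV.
  by move=> /(_ isT)/eqP; rewrite cycle_eq1 (negPf nty).
apply: (cyclic_abelem_prime _ _ ntP); last by rewrite defP cycle_cyclic.
exact: Sylow_abelem simS nabS ab2S _ _ (sylP p) ntP.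
Qed.

(** For [p = 2], [t] commutes with [z] and ranges over [R] without [1] and [z]. For odd [p], [t]
    inverts [z]: it ranges over ['N_S(R) :\: R], which consists of involutions, if the index is 2,
    and over nothing otherwise. *)
Lemma pair_count z p R : p.-Sylow(S) R -> p \in \pi(S) -> z \in R^# ->
  #|[set t in I | t * z \in I]| =
    if p == 2 then #|R| - 2 else if sylI p == 2 then #|R| else 0.
Proof.
move=> sylR pS Rz; have [/setD1P[nz Rz'] pR] := (Rz, pHall_pgroup sylR).
have sRS := pHall_sub sylR.
have ntR : R :!=: 1 by apply/trivgPn; exists z.
case: eqP => [p2|/eqP p2].
  have sqR y : y \in R -> y * y = 1.
    move=> Ry; have := Sylow_abelem simS nabS ab2S sylR ntR; rewrite p2.
    by case/abelemP => // _ /(_ y Ry); rewrite expgS expg1.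
  have VR y : y \in R -> y^-1 = y.
    by move=> Ry; apply: (mulgI y); rewrite mulgV sqR.
  have IR y : y \in R -> y != 1 -> y \in I.
    by move=> Ry ny; apply/involP; split; rewrite ?sqR ?(subsetP sRS).
  rewrite (_ : [set t in I | t * z \in I] = R^# :\ z).
    by rewrite (cardsD1 1 R) group1 (cardsD1 z R^#) Rz addnA addKn.
  apply/setP=> t; rewrite in_set !in_setD1; apply/andP/and3P.
    case=> /involP[St tt nt] /involP[_ tztz ntz]; split=> //.
      by apply: contraNneq ntz => ->; rewrite sqR.
    rewrite -(cent1S sylR Rz); apply/setIP; split=> //; apply/cent1P.
    rewrite /commute; rewrite mulgA in tztz.
    apply: (mulIg (t * z)); rewrite mulgA tztz -!mulgA [t * (t * z)]mulgA tt mul1g.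
    by rewrite sqR.
  case=> ntz nt Rt; split; first exact: IR.
  apply: IR; rewrite ?groupM //; apply: contraNneq ntz => tz1.
  by rewrite -[t]mulg1 -(sqR z Rz') mulgA tz1 mul1g.
case: eqP => l2.
  rewrite (_ : [set t in I | t * z \in I] = 'N_S(R) :\: R).
    have sRN : R \subset 'N_S(R) by rewrite subsetI (pHall_sub sylR) normG.
    rewrite cardsD (setIidPr sRN) -(Lagrange sRN) (norm_index sylR) l2.
    by rewrite muln2 -addnn addnK.
  apply/setP=> t; rewrite in_set in_setD; apply/andP/andP=> [[It Itz]|[nRt Nt]].
    by have [] := invol_norm sylR p2 Rz It Itz.
  split; apply: (norm_sqr sylR l2) => //; last by rewrite groupMr.
  by rewrite groupM // (subsetP _ _ Rz') // subsetI sRS normG.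
apply/eqP; rewrite cards_eq0 -subset0; apply/subsetP=> t; rewrite inE.
by case/andP=> It Itz; have [] := invol_norm sylR p2 Rz It Itz.
Qed.

Let syl_primes : {in primes #|S|, forall p, prime p}.
Proof. by move=> p; rewrite mem_primes => /andP[]. Qed.

Lemma invol_Sylow t : t \in I -> exists R, [/\ 2.-Sylow(S) R, t \in R^# & 'C_S[t] = R].
Proof.
move=> /involP[St tt nt]; have [|p [R [pS sylR Rt]]] := elt_in_Sylow simS nabS ab2S (x := t).
  exact/setD1P.
have ot : #[t] = 2 by apply: nt_prime_order; rewrite // expgS expg1.
have /setD1P[_ Rt'] := Rt; have := mem_p_elt (pHall_pgroup sylR) Rt'.
rewrite /p_elt ot pnatE // inE => /eqP p2; rewrite -p2 in sylR.
by exists R; split=> //; apply: cent1S sylR Rt.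
Qed.

(** Noncommuting involutions have a product of odd order, because 2-elements have order at most 2,
    so they are conjugate in the dihedral group that they generate. If [t] and [s] commute, [t] is
    replaced by a conjugate in another Sylow 2-subgroup, which cannot commute with [s]. *)
Lemma invol_conj t s : t \in I -> s \in I -> s \in t ^: S.
Proof.
move=> It Is.
have noncomm u : u \in I -> u * s != s * u -> s \in u ^: S.
  move=> Iu nc; have [[Su uu nu] [Ss ss ns]] := (involP _ Iu, involP _ Is).
  pose z := u * s.
  have uV : u^-1 = u by apply: (mulgI u); rewrite mulgV uu.
  have sV : s^-1 = s by apply: (mulgI s); rewrite mulgV ss.
  have Sz : z \in S^#.
    apply/setD1P; rewrite groupM //; split=> //; apply: contraNneq nc => z1.
    by rewrite -/z z1 -invg1 -z1 invMg uV sV.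
  have [p [R [pS sylR Rz]]] := elt_in_Sylow simS nabS ab2S Sz.
  have uz : u * z = s by rewrite mulgA uu mul1g.
  have np2 : p != 2.
    apply: contraNneq nc => p2; rewrite p2 in sylR.
    have ntR : R :!=: 1 by apply/trivgPn; exists z; case/setD1P: Rz.
    have /abelemP[//|_ exR] := Sylow_abelem simS nabS ab2S sylR ntR.
    have /setD1P[_ Rz'] := Rz; have := exR z Rz'; rewrite expgS expg1 => zz.
    have zV : z^-1 = z by apply: (mulgI z); rewrite mulgV zz.
    by rewrite -/z -zV invMg uV sV.
  have zu : z ^ u = z^-1 by rewrite conjgE uV mulgA uz /z invMg uV sV.
  have oz : odd #[z].
    have /setD1P[_ Rz'] := Rz; have pz := mem_p_elt (pHall_pgroup sylR) Rz'.
    rewrite odd_2'nat; apply: sub_in_pnat pz => x _.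
    by rewrite !inE => /eqP->.
  (* As [u] inverts [z], conjugation by [z ^+ k] sends [u] to [u * z ^+ k.*2]; here [k.*2 = #[z].+1]
     and [u * z = s]. *)
  apply/imsetP; exists (z ^+ uphalf #[z]).
    by rewrite groupX //; case/setD1P: Sz.
  rewrite conjgE -uz; set k := uphalf _.
  have -> : z ^- k = (z ^+ k) ^ u by rewrite conjXg zu expgVn.
  rewrite conjgE uV !mulgA -(mulgA u) -!(mulgA _ u u) uu mulg1.
  rewrite -mulgA -expgD addnn; congr (_ * _).
  rewrite (_ : k.*2 = #[z].+1) ?expgS ?expg_order ?mulg1 //.
  by rewrite /k uphalf_half oz doubleD -{2}(odd_double_half #[z]) oz.
have [R [sylR Rt CR]] := invol_Sylow It.
have [cts|] := eqVneq (t * s) (s * t); last exact: noncomm.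
have [St _ _] := involP _ It; have [Ss _ nts] := involP _ Is.
have Rs : s \in R^#.
  apply/setD1P; split=> //; rewrite -CR inE Ss; apply/cent1P; exact/esym.
have ntR : R :!=: 1 by apply/trivgPn; exists t; case/setD1P: Rt.
have [g Sg nRg] : exists2 g, g \in S & R :^ g != R.
  have := norm_proper simS ntR (Sylow_proper simS nabS sylR).
  move/proper_subn/subsetPn => [g Sg ng]; exists g => //.
  by apply: contra ng => /eqP E; rewrite inE Sg; apply/normP.
have It' : t ^ g \in I.
  have [_ tt nt] := involP _ It; apply/involP; rewrite groupJ ?conjg_eq1 //.
  by rewrite -conjMg tt conj1g.
have := noncomm _ It'; have -> : (t ^ g) ^: S = t ^: S by rewrite classGidl.
apply; apply: contraNneq nRg => cts'.
have Rt' : t ^ g \in R^#.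
  have [_ _ nt] := involP _ It'; apply/setD1P; split=> //.
  rewrite -(cent1S sylR Rs) inE groupJ //; apply/cent1P; exact/esym.
have sylRg : 2.-Sylow(S) (R :^ g)%G by rewrite pHallJ.
have Rt'' : t ^ g \in (R :^ g)%G^# by rewrite /= -conjD1g memJ_conjg.
by apply/eqP; apply: etrans (esym (cent1S sylRg Rt'')) (cent1S sylR Rt').
Qed.

Let A := #|syl 2|.
Let q := sylI 2.
Let m := #|I|.

Lemma even_prime2 : [/\ prime q, odd q & q \in \pi(S)].
Proof.
have [Q [[_ pq nq qS _] _]] := sylN_frob simS nabS ab2S evS; split=> //.
by case: (even_prime pq) nq => // ->.
Qed.

Lemma invol_elts : I = [set x in S^# | 2.-elt x].
Proof.
apply/setP=> x; rewrite [RHS]inE; apply/involP/andP => [[Sx xx nx]|].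
  split; first exact/setD1P.
  by rewrite /p_elt (@nt_prime_order _ 2) // expgS expg1.
case=> /setD1P[nx Sx] px.
have sxS : <[x]> \subset S by rewrite cycle_subG.
have [R sylR sxR] := Sylow_superset sxS px; rewrite cycle_subG in sxR.
have ntR : R :!=: 1 by apply/trivgPn; exists x.
have /abelemP[//|_ exR] := Sylow_abelem simS nabS ab2S sylR ntR.
by split=> //; have := exR x sxR; rewrite expgS expg1.
Qed.

(** The involutions form one class, of size [#|S| / A], and are the nontrivial 2-elements,
    [A.-1 * n] in number for [n] Sylow subgroups. Comparison with [#|S| = n * A * q] gives
    [A.-1 = q]. *)
Lemma card_invol : (A * m)%N = #|S| /\ A = q.+1.
Proof.
have ntP := syl_nt evS; have [t Pt nt] := trivgPn _ ntP.
have It : t \in I.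
  rewrite invol_elts inE; apply/andP; split.
    by apply/setD1P; rewrite nt (subsetP (pHall_sub (sylP 2))).
  exact: mem_p_elt (pHall_pgroup (sylP 2)) Pt.
have IE : I = t ^: S.
  apply/setP=> s; apply/idP/idP=> [|/imsetP[g Sg ->]]; first exact: invol_conj.
  have [St tt _] := involP _ It; apply/involP; rewrite groupJ ?conjg_eq1 //.
  by rewrite -conjMg tt conj1g.
have Pt' : t \in (syl 2)^# by apply/setD1P.
have Em : (A * m)%N = #|S|.
  rewrite /m IE -index_cent1 (cent1S (sylP 2) Pt') Lagrange //.
  exact: pHall_sub (sylP 2).
split=> //.
have Em2 : m = (A.-1 * #|S : sylN 2|)%N by rewrite /m invol_elts card_elts.
have En := sylN_index evS.
have n0 : 0 < #|S : sylN 2| := indexg_gt0 _ _.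
have A0 : 0 < A := cardG_gt0 _.
move: En; rewrite -Em Em2 -/A -/q mulnC -mulnA => /eqP.
rewrite eqn_pmul2l // eqn_pmul2r // => /eqP ->.
by rewrite prednK.
Qed.

(** The odd [p] whose Sylow normaliser is dihedral of order [2 * p]; for other odd primes no
    nontrivial [p]-element is a product of two involutions. *)
Definition dihedral_primes := [seq p <- primes #|S| | (p != 2) && (sylI p == 2)].
Local Notation B := dihedral_primes.

(* Double counting of the pairs of involutions according to their product. *)
Lemma even_count : (2 * m = 2 * q + q.+1 * \sum_(p <- B) p.-1)%N.
Proof.
have [Em EA] := card_invol.
pose f z := #|[set t in I | t * z \in I]|.
have pairs : (m * m = \sum_(z in S) f z)%N.
  rewrite /m -[in RHS]/m; transitivity (\sum_(t in I) \sum_(z in S) ((t * z)%g \in I)).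
    rewrite -sum_nat_const; apply: eq_bigr => t /involP[St _ _].
    rewrite (reindex_inj (mulgI t^-1)) /= -sum1_card big_mkcond [RHS]big_mkcond /=.
    apply: eq_bigr => s _; rewrite groupMl ?groupV // mulKVg.
    by case: ifP => [/involP[-> _ _]|_]; rewrite ?if_same.
  rewrite exchange_big /=; apply: eq_bigr => z _.
  rewrite /f -sum1_card [RHS](eq_bigl (fun t => (t \in I) && (t * z \in I))) => [|t].
    by rewrite big_mkcondr; apply: eq_bigr => t _; case: (_ \in _).
  by rewrite inE.
have f1 : f 1 = m.
  by apply: eq_card => t; rewrite !inE mulg1 andbb.
have m0 : 0 < m by have := cardG_gt0 S; rewrite -Em muln_gt0 => /andP[].
(* The factor 2 avoids halving: [p.-1 * n] elements contribute [p] each, and [2 * p * n = #|S|]. *)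
have sumP p : p \in primes #|S| -> (2 * \sum_(z in [set x in S^# | p.-elt x]) f z =
    if p == 2 then 2 * (m * (A - 2)) else if sylI p == 2 then #|S| * p.-1 else 0)%N.
  move=> pS; rewrite (eq_bigr (fun=> if p == 2 then #|syl p| - 2 else
      if sylI p == 2 then #|syl p| else 0)); last first.
    move=> z; rewrite -class_support_syl // => /imset2P[y g Py Sg ->].
    have sylPg : p.-Sylow(S) (syl p :^ g)%G by rewrite pHallJ ?sylP.
    rewrite -(cardJg (syl p) g) -(pair_count sylPg pS (z := y ^ g)) //.
    by rewrite /= -conjD1g memJ_conjg.
  rewrite sum_nat_const; case: eqP => [p2|/eqP p2].
    by rewrite p2 -invol_elts.
  case: eqP => l2; last by rewrite !muln0.
  rewrite card_elts // -(sylN_index pS) l2.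
  rewrite (sylI2_order (sylP p) pS l2); move: #|S : sylN p| p.-1 => n k; clear; lia.
have : (2 * (m * m) = 2 * m + 2 * (m * (A - 2)) + #|S| * \sum_(p <- B) p.-1)%N.
  rewrite pairs (big_setD1 1) //= f1 mulnDr -addnA; congr (_ + _)%N.
  rewrite (big_elts simS nabS ab2S) big_distrr /= (eq_big_seq _ sumP).
  rewrite (bigD1_seq 2) ?primes_uniq //=; congr (_ + _)%N.
  rewrite /B big_filter big_distrr /= [LHS]big_mkcond [RHS]big_mkcond /=.
  by apply: eq_bigr => p _; case: eqP => //=; case: eqP.
rewrite -Em EA; have [pq _ _] := even_prime2; have q1 := prime_gt1 pq.
set s := \sum_(_ <- _) _ => E; apply/eqP; rewrite -(eqn_pmul2r m0); apply/eqP.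
have e2 : (q.+1 - 2 = q.-1)%N by lia.
move: E; rewrite e2; case: (q) q1 => // q' _ /=; clear; lia.
Qed.

(** No dihedral prime gives [m = q], hence a normal Sylow 2-subgroup; one is impossible; two give
    [q = 3] and [m = 15]; three already account for too many elements. *)
Lemma even_card : #|S| = 60 /\ #|S : sylN 2| = 5.
Proof.
have [Em EA] := card_invol; have [pq oq qS] := even_prime2.
have Ec := even_count; have En := sylN_index evS.
have qm : q %| m.
  have : q %| q.+1 * m by rewrite -EA Em; move: qS; rewrite mem_primes => /and3P[].
  by rewrite Gauss_dvdr // coprimenS.
have BP p : p \in B -> [/\ prime p, odd p, p %| q.+1 * m & (#|S : sylN p| * (p * 2) = #|S|)%N].
  rewrite mem_filter => /andP[/andP[p2 /eqP l2] pS]; have pp := syl_primes pS.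
  split=> //; first by case: (even_prime pp) p2 => // ->.
    by rewrite -EA Em; move: pS; rewrite mem_primes => /and3P[].
  rewrite -(sylN_index pS) l2 //.
  by rewrite (sylI2_order (sylP p) pS l2).
have fin : q = 3 -> m = 15 -> #|S| = 60 /\ #|S : sylN 2| = 5.
  move=> q3 m15; have g60 : #|S| = 60 by rewrite -Em EA q3 m15.
  by split=> //; move: En; rewrite g60 -/A EA -/q q3; lia.
have srtB : sorted ltn B by apply: sorted_filter (sorted_primes _); apply: ltn_trans.
have A2 : q.+1 = (2 ^ logn 2 #|S|)%N by rewrite -EA /A (card_Hall (sylP 2)) p_part.
have cnt : \sum_(p <- B) (p.-1 * #|S : sylN p|) < #|S|.
  rewrite (card_partition simS nabS ab2S) add1n ltnS.
  rewrite /B big_filter big_mkcond /=; rewrite big_seq_cond [leqRHS]big_seq_cond.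
  apply: leq_sum => p; rewrite andbT => pS; case: ifP => // /andP[_ /eqP l2].
  by rewrite (sylI2_order (sylP p) pS l2).
case EB : B srtB => [|p [|r [|s B']]] /=.
- move: Ec; rewrite EB big_nil muln0 addn0 => Ec _.
  have Eq : m = q by lia.
  have n1 : #|S : sylN 2| = 1%N.
    apply/eqP; rewrite -(eqn_pmul2r (cardG_gt0 S)) mul1n -{2}En -Em Eq -/A -/q.
    by rewrite mulnA.
  have := sylN_proper simS nabS evS; rewrite properE => /andP[sNS].
  by rewrite -indexg_eq1 n1.
- move: Ec; rewrite EB big_seq1 => Ec _.
  have [|pp op pg _] := BP p; first by rewrite EB mem_head.
  by have := even_arith1 pq oq pp op Ec qm pg.
- move: Ec; rewrite EB big_cons big_seq1 => Ec; rewrite andbT => ltpr.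
  have [|pp op pg _] := BP p; first by rewrite EB mem_head.
  have [|pr or rg _] := BP r; first by rewrite EB !inE eqxx orbT.
  have [|q3 m15] := even_arith2 pq oq pp op pr or _ A2 Ec qm pg rg; last exact: fin.
  by rewrite neq_ltn ltpr.
case/and3P=> ltpr ltrs _.
have [|pp op _ np] := BP p; first by rewrite EB mem_head.
have [|_ _ _ nr] := BP r; first by rewrite EB !inE eqxx orbT.
have [|_ _ _ ns] := BP s; first by rewrite EB !inE eqxx !orbT.
move: cnt; rewrite EB !big_cons; have p3 : 2 < p by rewrite odd_prime_gt2.
move: np nr ns; set a := #|S : sylN p|; set b := #|S : _|; set c := #|S : _|.
set g := #|S|; move: (\sum_(_ <- _) _) => z; move: a b c g => a b c g.
move=> Ea Eb Ec' lt; exfalso; clear -Ea Eb Ec' lt p3 ltpr ltrs.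
(* From [p >= 3], [r >= 4], [s >= 5] the three primes provide at least 1/3, 3/8 and 2/5 of the
   elements, which exceeds 1 in total. *)
have la : 6 * a <= g by nia.
have lb : 8 * b <= g by nia.
have lc : 10 * c <= g by nia.
have E1 : (2 * (p.-1 * a) + 2 * a = g)%N by nia.
have E2 : (2 * (r.-1 * b) + 2 * b = g)%N by nia.
have E3 : (2 * (s.-1 * c) + 2 * c = g)%N by nia.
lia.
Qed.

End Even.

End EvenOrder.

(** * Odd order *)

Section ExceptionalCharacters.
Import Order.TTheory GroupScope GRing.Theory Num.Theory.
Local Open Scope ring_scope.

Lemma sum_fpf_involution (V : nmodType) (T : finType) (s : T -> T) (P : pred T)
    (F : T -> V) :
  involutive s -> (forall x, P (s x) = P x) -> (forall x, P x -> s x != x) ->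
  \sum_(x | P x) F x =
  \sum_(x | P x && (enum_rank x < enum_rank (s x))%N) (F x + F (s x)).
Proof.
move=> sK Ps nfix; rewrite (bigID (fun x => (enum_rank x < enum_rank (s x))%N)) /=.
rewrite big_split /=; congr (_ + _).
rewrite (reindex_inj (inv_inj sK)) /=; apply: eq_bigl => x; rewrite Ps sK.
case Px: (P x) => //=; rewrite -leqNgt leq_eqVlt.
by rewrite (inj_eq val_inj) (inj_eq enum_rank_inj) eq_sym (negPf (nfix x Px)).
Qed.

Lemma odd_inv_fpf (gT : finGroupType) (G : {group gT}) x :
  odd #|G| -> x \in G^#%g -> (x^-1 != x)%g.
Proof.
move=> oG /setD1P[nx Gx]; apply: contra nx => /eqP E; rewrite -order_eq1.
have d2 : (#[x] %| 2)%N by rewrite order_dvdn expgS expg1 -{1}E mulVg.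
have od : odd #[x] by rewrite (dvdn_odd (order_dvdG Gx)).
by move: (dvdn_leq (ltn0Sn 1) d2) od (order_gt0 x); case: #[x]%g => [|[|[]]].
Qed.

(** Burnside: for a real character, pairing [x] with its inverse in the orthogonality to the
    principal character gives ['chi_i 1%g = - (2 * a)] with [a] an algebraic integer; [a] is
    rational, hence an integer, but the degree is odd. *)
Lemma odd_irr_nonreal (gT : finGroupType) (G : {group gT}) (i : Iirr G) :
  odd #|G| -> i != 0 -> conjC_Iirr i != i.
Proof.
move=> oG ni; apply/eqP => Ei.
have real x : 'chi_i x^-1%g = 'chi_i x.
  by rewrite -[in RHS]Ei conjC_IirrE cfunE irr_inv.
have d0 : '['chi_i, 'chi_0] = 0 by rewrite cfdot_irr (negPf ni).
pose a := \sum_(x | (x \in G^#)%g && (enum_rank x < enum_rank x^-1%g)%N) 'chi_i x.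
have E : 'chi_i 1%g = - (2 * a).
  apply/eqP; rewrite -addr_eq0; move: d0; rewrite irr0 cfdotE => /eqP.
  rewrite mulf_eq0 invr_eq0 (negPf (neq0CG _)) /= => /eqP <-; apply/eqP.
  rewrite (big_setD1 1%g) //= cfun1E group1 rmorph1 mulr1; congr (_ + _).
  have -> : \sum_(x in G^#%g) 'chi_i x * ((1 : 'CF(G)) x)^* = \sum_(x in G^#%g) 'chi_i x.
    by apply: eq_bigr => x /setD1P[_ Gx]; rewrite cfun1E Gx rmorph1 mulr1.
  rewrite (sum_fpf_involution _ (@invgK gT)) => [|x|x Gx].
  - rewrite big_distrr /=; apply: eq_bigr => x _.
    by rewrite real mulr_natl mulr2n.
  - by rewrite !inE groupV invg_eq1.
  - exact: odd_inv_fpf oG Gx.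
have Aa : a \in Aint by apply: rpred_sum => x _; apply: Aint_irr.
have /natrP[n En] := Cnat_irr1 i.
have Ea : a = - (n%:R / 2).
  by rewrite -En E mulNr opprK mulrC mulKf // pnatr_eq0.
have Za : a \in Num.int.
  apply: Cint_rat_Aint Aa; rewrite Ea.
  by rewrite rpredN rpred_div // rpred_nat.
have := dvd_irr1_cardG i; rewrite En dvdC_nat => dn.
have on : odd n.
  exact: dvdn_odd dn oG.
have /intrP[z Ez] : - a \in Num.int by rewrite rpredN.
have : n%:R = (2 * z)%:~R :> algC.
  by rewrite -En E intrM -Ez mulrN.
rewrite -[n%:R]/(n%:~R) => En2.
have nz : n%:Z = 2 * z by apply: (@intr_inj algC).
have : (2 %| n%:Z)%Z by rewrite nz dvdz_mulr.
by rewrite dvdzE /= dvdn2 on.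
Qed.

Lemma normedTI_isometry (gT : finGroupType) (A : {set gT}) (G L : {group gT}) :
  normedTI A G L -> {in 'CF(L, A) &, isometry 'Ind[G, L]}.
Proof.
move=> tiA phi psi phiA psiA; have [_ sLG memJ] := normedTI_memJ_P tiA.
rewrite -cfdot_Res_r !(cfdotEl _ phiA); congr (_ * _).
apply: eq_bigr => x Ax; congr (_ * _^*).
have [Lx|nLx] := boolP (x \in L); last by rewrite !cfun0.
rewrite cfResE // cfIndE // (big_setID L) /= (setIidPr sLG).
rewrite (eq_bigr (fun=> psi x)) => [|y Ly]; last by rewrite cfunJ.
rewrite [X in _ + X]big1 ?addr0 => [|y /setDP[Gy nLy]]; last first.
  by apply: (cfun_onP psiA); rewrite memJ.
by rewrite sumr_const -[psi x *+ _]mulr_natl mulKf ?neq0CG.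
Qed.

Lemma normedTI_sum (gT : finGroupType) (A : {set gT}) (G L : {group gT})
    (V : nmodType) (F : gT -> V) :
  normedTI A G L -> (forall x g, g \in G -> F (x ^ g)%g = F x) ->
  \sum_(x in class_support A G) F x = (\sum_(x in A) F x) *+ #|G : L|.
Proof.
move=> tiA FJ; have [_ _ /eqP NL] := and3P tiA.
rewrite (set_partition_big _ (partition_normedTI tiA)) /= -NL -card_conjugates.
rewrite -sumr_const; apply: eq_bigr => _ /imsetP[g Gg ->].
rewrite big_imset /=; last by move=> x y _ _; apply: conjg_inj.
by apply: eq_bigr => x _; rewrite FJ.
Qed.

(* Bounds below the variance of the multiplicities of the linear characters of a
   TI subgroup P in an exceptional character, which take different values on the
   two disjoint classes [Ind_class] of a character and of its conjugate. *)
Lemma variance_lb (T : finType) (c : T -> int) (A B : {set T}) (u : int) :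
  [disjoint A & B] -> #|A| = #|B| -> {in A, forall x, c x = u} ->
  {in B, forall x, c x = u - 1} ->
  (#|A| * (#|T| - #|A|))%:R + (\sum_x c x) ^+ 2 <= #|T|%:R * \sum_x c x ^+ 2.
Proof.
move=> dAB cAB cA cB; set l := #|A|; set t := #|T|.
pose D x y := (c x - c y) ^+ 2.
have sumD : \sum_x \sum_y D x y = (t%:R * \sum_x c x ^+ 2 - (\sum_x c x) ^+ 2) *+ 2.
  transitivity (\sum_x (t%:R * c x ^+ 2 + \sum_y c y ^+ 2 - c x * (\sum_y c y) *+ 2)).
    apply: eq_bigr => x _; rewrite mulr_sumr -sumrMnl.
    rewrite mulr_natl -[c x ^+ 2 *+ t]sumr_const -sumrN -!big_split /=.
    by apply: eq_bigr => y _; rewrite /D sqrrB addrAC.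
  rewrite !big_split /= sumrN sumrMnl -mulr_sumr -mulr_suml sumr_const -/t.
  rewrite -[_ *+ t]mulr_natl; move: (\sum_i _ ^+ 2) (\sum_i c i) => a b; ring.
have D0 x y : 0 <= D x y by rewrite sqr_ge0.
have sym x y : D x y = D y x by rewrite /D -sqrrN opprB.
pose U := A :|: B.
have cU : #|U| = l.*2 by rewrite cardsU disjoint_setI0 // cards0 subn0 -cAB addnn.
(* For an integer [w], [w] and [w + 1] are not both zero, so [w ^+ 2 + (w + 1) ^+ 2 >= 1]. *)
have lb x : l%:R <= \sum_(y in U) D x y.
  have eA : \sum_(y in A) D x y = (c x - u) ^+ 2 *+ l.
    by rewrite -sumr_const; apply: eq_bigr => y Ay; rewrite /D (cA y Ay).
  have eB : \sum_(y in B) D x y = (c x - u + 1) ^+ 2 *+ l.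
    rewrite /l cAB -sumr_const; apply: eq_bigr => y By.
    by rewrite /D (cB y By) opprB addrCA addrC.
  have -> : \sum_(y in U) D x y = \sum_(y in A) D x y + \sum_(y in B) D x y.
    rewrite (big_setID A) /= setUK setDUl setDv set0U (setDidPl _) //.
    by rewrite disjoint_sym.
  rewrite eA eB -mulrnDl lerMn2r; apply/orP; right.
  move: (c x - u) => w; have [w0|w0] := lerP 0 w.
    by rewrite -[leLHS]add0r lerD ?sqr_ge0 // expr_ge1 // ?addr_ge0 // lerDr.
  have : 1 <= - w by rewrite -gtz0_ge1 oppr_gt0.
  by move=> w1; rewrite -[leLHS]addr0 lerD ?sqr_ge0 // -sqrrN expr_ge1 // (le_trans _ w1).
(* The bound [lb] is used for the pairs with second entry in [U], then for those with first entry in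
   [U] and second outside: [t * l + (t - 2 * l) * l]. *)
have : (l * (t - l))%:R *+ 2 <= \sum_x \sum_y D x y.
  have -> : \sum_x \sum_y D x y = \sum_x \sum_(y in U) D x y + \sum_(y in ~: U) \sum_x D x y.
    rewrite [X in _ + X]exchange_big -big_split; apply: eq_bigr => x _ /=.
    by rewrite (bigID (mem U)) /=; congr (_ + _); apply: eq_bigl => y; rewrite !inE.
  apply: le_trans (_ : \sum_(x : T) l%:R + \sum_(y in ~: U) l%:R <= _).
    rewrite !sumr_const cardsCs setCK cU -/t.
    have : (l.*2 <= t)%N by rewrite -cU max_card.
    rewrite -!mulrnA -natrD ler_nat => h; rewrite -(subnKC h).
    by move: (t - _)%N => s; lia.
  apply: lerD; first by apply: ler_sum.
  apply: ler_sum => y _; apply: le_trans (lb y) _.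
  rewrite [leRHS](bigID (mem U)) /= -[leLHS]addr0 lerD //.
    by apply: ler_sum => x _; rewrite sym.
  by apply: sumr_ge0.
by rewrite sumD lerMn2r /= lerBrDr.
Qed.

(** * Exceptional characters of one TI subgroup *)

Section TISub.
Variables (gT : finGroupType) (S N P : {group gT}).
Hypotheses (oddS : odd #|S|) (tiP : normedTI P^# S N) (abP : abelian P).
Hypotheses (nPN : P <| N) (frobN : [Frobenius N with kernel P]).

Let sNS : N \subset S. Proof. by have [_] := normedTI_memJ_P tiP. Qed.
Let sPN : P \subset N := normal_sub nPN.
Let sPS : P \subset S := subset_trans sPN sNS.
Let l := #|N : P|.

Let lin1 (i : Iirr P) : 'chi_i 1%g = 1.
Proof. by apply: lin_char1; apply: char_abelianP. Qed.

Lemma TI_sub_on (i j : Iirr P) : 'chi_i - 'chi_j \in 'CF(P, P^#).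
Proof. by rewrite cfunD1E !cfunE !lin1 subrr. Qed.

Lemma TI_isom (phi psi : 'CF(P)) : phi \in 'CF(P, P^#) -> psi \in 'CF(P, P^#) ->
  '['Ind[S] phi, 'Ind[S] psi] = '['Ind[N] phi, 'Ind[N] psi].
Proof.
have on f : f \in 'CF(P, P^#) -> 'Ind[N] f \in 'CF(N, P^#).
  move=> fP; have := cfInd_on sPN fP; rewrite class_supportEr => h.
  apply: cfun_onS h; apply/bigcupsP=> x Nx; rewrite conjD1g (normsP _ x Nx) //.
  exact: normal_norm.
move=> /on phiN /on psiN.
by rewrite -(normedTI_isometry tiP phiN psiN) !cfIndInd.
Qed.

Lemma TI_Ind_irr i : i != 0 -> 'Ind[N, P] 'chi_i \in irr N.
Proof. exact: irr_induced_Frobenius_ker. Qed.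

Lemma TI_Ind_dot (i j : Iirr P) : i != 0 -> j != 0 ->
  '['Ind[N] 'chi_i, 'Ind[N] 'chi_j] = ('Ind[N] 'chi_i == 'Ind[N] 'chi_j)%:R.
Proof.
move=> /TI_Ind_irr/irrP[a ->] /TI_Ind_irr/irrP[b ->].
by rewrite cfdot_irr (inj_eq irr_inj).
Qed.

Lemma TI_Ind_dot0 (i : Iirr P) : i != 0 -> '['Ind[N] 'chi_i, 'Ind[N, P] 1] = 0.
Proof.
move=> ni; have /irrP[a Ea] := TI_Ind_irr ni.
have := elimT (Frobenius_Ind_irrP frobN a) _.
have nk : ~~ (P \subset cfker 'chi_a).
  by apply/(Frobenius_Ind_irrP frobN); exists i.
rewrite Ea => _; apply: contraNeq nk => nz.
apply: (constt0_Res_cfker nPN).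
by rewrite irr_consttE irr0 cfdot_Res_l.
Qed.

(** For [i != 0], the [N]-orbit of [i], read off from the induced characters. *)
Definition Ind_class (i : Iirr P) : {set Iirr P} :=
  [set k | (k != 0) && ('Ind[N] 'chi_k == 'Ind[N] 'chi_i)].

(** The restriction to [P] of ['Ind[N] 'chi_i], of degree [l], is the multiplicity-free sum of the
    orbit. *)
Lemma card_Ind_class i : i != 0 -> #|Ind_class i| = l.
Proof.
move=> ni; apply/eqP; rewrite -eqC_nat; apply/eqP.
have := cfInd1 'chi_i sPN; rewrite lin1 mulr1 => <-.
rewrite -(cfRes1 P) [in RHS](cfun_sum_cfdot ('Res[P] _)) sum_cfunE -sum1_card natr_sum.
rewrite big_mkcond; apply: eq_bigr => k _.
rewrite cfunE lin1 mulr1 inE cfdot_Res_l.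
have [->|nk] := eqVneq k 0; first by rewrite irr0 TI_Ind_dot0.
by rewrite TI_Ind_dot // eq_sym; case: eqP.
Qed.

Lemma TI_Ind_real (i : Iirr P) : i != 0 ->
  'Ind[N] 'chi_(conjC_Iirr i) != 'Ind[N] 'chi_i.
Proof.
move=> ni; have /irrP[a Ea] := TI_Ind_irr ni.
have na : a != 0.
  apply/eqP => a0; have /eqP := TI_Ind_dot0 ni.
  by rewrite Ea a0 irr0 -cfdot_Res_l cfRes_cfun1 // cfnorm1 oner_eq0.
rewrite conjC_IirrE -cfAutInd Ea -conjC_IirrE (inj_eq irr_inj).
by apply: odd_irr_nonreal na; apply: dvdn_odd (cardSg sNS) oddS.
Qed.

Lemma TI_norm1 (i : Iirr P) : i != 0 ->
  '['Ind[S] ('chi_0 - 'chi_i)] = l.+1%:R.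
Proof.
move=> ni; rewrite TI_isom ?TI_sub_on // linearB cfnormBd.
  rewrite irr0 cfnorm_Ind_cfun1 // TI_Ind_dot // eqxx.
  by rewrite -(natrD _ l 1) addn1.
by rewrite irr0 cfdotC TI_Ind_dot0 // conjC0.
Qed.

Lemma TI_norm2 (i j : Iirr P) : i != 0 -> j != 0 ->
  'Ind[N] 'chi_i != 'Ind[N] 'chi_j ->
  exists a b : Iirr S, a != b /\ 'Ind[S] ('chi_i - 'chi_j) = 'chi_a - 'chi_b.
Proof.
move=> ni nj nij.
have [|| a [b nab E]] := @vchar_norm2 _ S ('Ind[S] ('chi_i - 'chi_j)).
- rewrite zcharD1E cfInd_vchar ?rpredB ?irr_vchar //.
  by rewrite cfInd1 // !cfunE !lin1 subrr mulr0 eqxx.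
- rewrite TI_isom ?TI_sub_on // linearB /= cfnormBd !TI_Ind_dot ?eqxx //.
  by rewrite (negPf nij).
by exists a, b; rewrite eq_sym.
Qed.

(** The induced difference is some ['chi_a - 'chi_b] by [TI_norm2]; complex conjugation changes its
    sign, so [b] is the conjugate of [a]. *)
Lemma TI_exc (i : Iirr P) : i != 0 -> exists a : Iirr S,
  'Ind[S] ('chi_i - 'chi_(conjC_Iirr i)) = 'chi_a - 'chi_(conjC_Iirr a) /\
  conjC_Iirr a != a.
Proof.
move=> ni; have nci : conjC_Iirr i != 0 by rewrite conjC_Iirr_eq0.
have [|a [b [nab E]]] := TI_norm2 ni nci; first by rewrite eq_sym TI_Ind_real.
suff Eb : conjC_Iirr a = b by exists a; rewrite Eb eq_sym.
have := congr1 (fun f => f^*%CF) E; rewrite cfAutInd !rmorphB /= -!conjC_IirrE.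
rewrite conjC_IirrK -opprB linearN /= E opprB => /(congr1 (cfdot^~ 'chi_b)).
rewrite !cfdotBl !cfdot_irr eqxx (negPf nab) subr0.
have [//|_] := eqVneq (conjC_Iirr a) b.
by rewrite sub0r => /eqP; rewrite -addr_eq0 -(natrD _ 1) pnatr_eq0.
Qed.
End TISub.

Definition exceptional (gT : finGroupType) (S P : {group gT}) (i : Iirr P) (a : Iirr S) :=
  'Ind[S] ('chi_i - 'chi_(conjC_Iirr i)) = 'chi_a - 'chi_(conjC_Iirr a) /\
  conjC_Iirr a != a.

Lemma exceptional_irr_ortho (gT : finGroupType) (S P : {group gT}) (i : Iirr P)
    (a b c : Iirr S) :
  exceptional i a ->
  '['chi_b - 'chi_c, 'Ind[S] ('chi_i - 'chi_(conjC_Iirr i))] = 0 ->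
  '['chi_b - 'chi_c, 'chi_a] = 0.
Proof.
case=> -> na; rewrite cfdotBr !cfdotBl !cfdot_irr.
have [->|nb] := eqVneq b a; have [->|nc] := eqVneq c a; rewrite ?subrr //.
- rewrite eq_sym (negPf na) subr0 sub0r opprK => /eqP.
  by rewrite -(natrD _ 1) pnatr_eq0.
- rewrite [a == _]eq_sym (negPf na) subr0 sub0r => /eqP.
  by rewrite -opprD oppr_eq0 -(natrD _ 1) pnatr_eq0.
Qed.

Section TISub.
Variables (gT : finGroupType) (S N P : {group gT}).
Hypotheses (oddS : odd #|S|) (tiP : normedTI P^# S N) (abP : abelian P).
Hypotheses (nPN : P <| N) (frobN : [Frobenius N with kernel P]).

Let sNS : N \subset S. Proof. by have [_] := normedTI_memJ_P tiP. Qed.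
Let sPN : P \subset N := normal_sub nPN.
Let sPS : P \subset S := subset_trans sPN sNS.
Let l := #|N : P|.

Let lin1 (i : Iirr P) : 'chi_i 1%g = 1.
Proof. by apply: lin_char1; apply: char_abelianP. Qed.

(** The multiplicities [c k] of linear characters in ['Res[P] 'chi_a] are constant on orbits and
    drop by 1 from the orbit of [i] to that of its conjugate. By orthogonality on [P], the sum is
    [#|P|] times the sum of their squares, minus the square of their sum; so [variance_lb]
    applies. *)
Lemma exceptional_norm_lb (i : Iirr P) (a : Iirr S) : i != 0 -> exceptional i a ->
  (l * (#|P| - l))%:R <= \sum_(x in P^#) `|'chi_a x| ^+ 2.
Proof.
move=> ni [Ea na].
have Cn k : exists n : nat, '['Res[P] 'chi_a, 'chi_k] == n%:R.
  by have /natrP[n ->] := Cnat_cfdot_char_irr k (cfRes_char P (irr_char a)); exists n.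
have [c Ec] := fin_all_exists Cn.
have {}Ec k : '['chi_a, 'Ind[S] 'chi_k] = (c k)%:R by rewrite -cfdot_Res_l; apply/eqP.
have classE k j : k \in Ind_class N j -> c k = c j.
  rewrite inE => /andP[_ /eqP E]; apply/eqP; rewrite -eqC_nat -!Ec.
  by rewrite -(cfIndInd _ sNS sPN) E cfIndInd.
have cconj : (c i = c (conjC_Iirr i) + 1)%N.
  have : (c i)%:R - (c (conjC_Iirr i))%:R = 1 :> algC.
    rewrite -!Ec -cfdotBr -linearB /= Ea cfdotBr !cfdot_irr eqxx.
    by rewrite eq_sym (negPf na) subr0.
  by move/eqP; rewrite subr_eq addrC -(natrD _ _ 1) eqr_nat => /eqP.
have nci : conjC_Iirr i != 0 by rewrite conjC_Iirr_eq0.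
have dis : [disjoint Ind_class N i & Ind_class N (conjC_Iirr i)].
  rewrite -setI_eq0 -subset0; apply/subsetP=> k; rewrite !inE.
  case/andP=> /andP[_ /eqP->] /andP[_]; rewrite eq_sym.
  by rewrite (negPf (TI_Ind_real oddS tiP nPN frobN ni)).
have cl (j : Iirr P) : j != 0 -> #|Ind_class N j| = l by exact: (card_Ind_class abP nPN frobN).
have := @variance_lb _ (fun k => (c k)%:Z) _ _ (c i)%:Z dis.
rewrite !cl // => /(_ erefl) h.
have {}h : ((l * (#|P| - l))%:R + (\sum_k (c k)%:R) ^+ 2 <= #|P|%:R * \sum_k (c k)%:R ^+ 2 :> algC).
  have : (l * (#|Iirr P| - l))%:R + (\sum_k (c k)%:Z) ^+ 2 <= #|Iirr P|%:R * \sum_k (c k)%:Z ^+ 2 :> int.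
    apply: h => k /classE->; rewrite ?cconj //.
    by rewrite PoszD addrK.
  have e1 : (\sum_k (c k)%:Z)%:~R = \sum_k (c k)%:R :> algC by rewrite rmorph_sum.
  have e2 : (\sum_k (c k)%:Z ^+ 2)%:~R = \sum_k (c k)%:R ^+ 2 :> algC.
    by rewrite rmorph_sum; apply: eq_bigr => k _; rewrite rmorphXn.
  rewrite card_Iirr_abelian // -(ler_int algC).
  rewrite (_ : (_ + _)%:~R = (l * (#|P| - l))%:R + (\sum_k (c k)%:R) ^+ 2); last first.
    by rewrite -e1 -rmorphXn rmorphD /= rmorph_nat.
  rewrite (_ : (_ * _)%:~R = #|P|%:R * (\sum_k (c k)%:R ^+ 2)) //.
  by rewrite -e2 rmorphM /= rmorph_nat.
have deg : 'chi_a 1%g = \sum_k (c k)%:R.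
  rewrite -(cfRes1 P) [in LHS](cfun_sum_cfdot ('Res[P] _)) sum_cfunE.
  by apply: eq_bigr => k _; rewrite cfunE lin1 mulr1 cfdot_Res_l Ec.
have nrm : \sum_(x in P) `|'chi_a x| ^+ 2 = #|P|%:R * \sum_k (c k)%:R ^+ 2.
  have -> : \sum_k ((c k)%:R : algC) ^+ 2 = '['Res[P] 'chi_a].
    rewrite cfdot_sum_irr; apply: eq_bigr => k _.
    by rewrite cfdot_Res_l Ec rmorph_nat.
  rewrite cfdotE mulVKf ?neq0CG //; apply: eq_bigr => x Px.
  by rewrite cfResE // normCK.
have s0 : 0 <= \sum_k (c k)%:R :> algC by apply: sumr_ge0 => k _; apply: ler0n.
by move: h; rewrite -nrm (big_setD1 1%g) //= deg ger0_norm // [leLHS]addrC lerD2l.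
Qed.
End TISub.

(** * Two TI subgroups with disjoint supports *)

Section TwoTISub.
Variables (gT : finGroupType) (S P1 P2 N2 : {group gT}).
Hypotheses (oddS : odd #|S|) (sP1 : P1 \subset S) (abP1 : abelian P1).
Hypotheses (tiP2 : normedTI P2^# S N2) (abP2 : abelian P2) (nP2 : P2 <| N2).
Hypothesis frob2 : [Frobenius N2 with kernel P2].
Hypothesis dis : [disjoint class_support P1^# S & class_support P2^# S].

Let sN2 : N2 \subset S. Proof. by have [_] := normedTI_memJ_P tiP2. Qed.
Let sP2 : P2 \subset S := subset_trans (normal_sub nP2) sN2.

Lemma abelian_irr1 (P : {group gT}) (i : Iirr P) : abelian P -> 'chi_i 1%g = 1.
Proof. by move=> abP; apply: lin_char1; apply: char_abelianP. Qed.

Lemma sub_irr_on (P : {group gT}) (i j : Iirr P) :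
  abelian P -> 'chi_i - 'chi_j \in 'CF(P, P^#).
Proof. by move=> abP; rewrite cfunD1E !cfunE !abelian_irr1 // subrr. Qed.

Lemma Ind_ortho (phi : 'CF(P1)) (psi : 'CF(P2)) :
  phi \in 'CF(P1, P1^#) -> psi \in 'CF(P2, P2^#) ->
  '['Ind[S] phi, 'Ind[S] psi] = 0.
Proof.
move=> phiP psiP; rewrite (cfdotEl _ (cfInd_on sP1 phiP)) big1 ?mulr0 // => x Px.
rewrite (cfun_onP (cfInd_on sP2 psiP)) ?conjC0 ?mulr0 //.
by rewrite (disjointFr dis).
Qed.

(** Unless it is zero, ['Ind[S] ('chi_j - 'chi_k)] is a difference of two irreducible characters;
    disjoint supports make it orthogonal to the difference defining [a], hence to ['chi_a]. *)
Lemma exceptional_const (i : Iirr P1) (a : Iirr S) (j k : Iirr P2) :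
  exceptional i a -> j != 0 -> k != 0 ->
  '['chi_a, 'Ind[S] 'chi_j] = '['chi_a, 'Ind[S] 'chi_k].
Proof.
move=> exa nj nk; have [E|neq] := eqVneq ('Ind[N2] 'chi_j) ('Ind[N2] 'chi_k).
  by rewrite -(cfIndInd _ sN2 (normal_sub nP2)) E (cfIndInd _ sN2 (normal_sub nP2)).
have [b [c [_ E]]] := TI_norm2 tiP2 abP2 nP2 frob2 nj nk neq.
apply/eqP; rewrite -subr_eq0 -cfdotBr -linearB /= E cfdotC.
rewrite (exceptional_irr_ortho exa) ?conjC0 // -E cfdotC.
by rewrite Ind_ortho ?conjC0 ?sub_irr_on.
Qed.

(** All nontrivial characters of [P2] have the same multiplicity in ['chi_a], and by the regular
    character their sum is [-1] off the identity. *)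
Lemma exceptional_val (i : Iirr P1) (a : Iirr S) (j : Iirr P2) x :
  exceptional i a -> j != 0 -> x \in P2^# ->
  'chi_a x = '['chi_a, 'Ind[S] ('chi_0 - 'chi_j)].
Proof.
move=> exa nj /setD1P[nx Px].
rewrite linearB /= cfdotBr -(cfResE _ sP2 Px) [in LHS](cfun_sum_cfdot ('Res _)) sum_cfunE.
rewrite (bigD1 0) //= cfunE irr0 cfun1E Px mulr1 cfdot_Res_l; congr (_ + _).
rewrite (eq_bigr (fun k => '['chi_a, 'Ind[S] 'chi_j] * 'chi_k x)) => [|k nk]; last first.
  by rewrite cfunE cfdot_Res_l (exceptional_const exa nk nj).
rewrite -big_distrr /=.
have : cfReg P2 x = 0 by rewrite cfRegE (negPf nx).
rewrite cfReg_sum sum_cfunE (bigD1 0) //= cfunE abelian_irr1 // mul1r.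
rewrite irr0 cfun1E Px (eq_bigr (fun k : Iirr P2 => 'chi_k x)) => [|k _]; last first.
  by rewrite cfunE abelian_irr1 // mul1r.
move/eqP; rewrite addrC addr_eq0 => /eqP->.
by rewrite mulrN1.
Qed.
End TwoTISub.

(** Conjugating ['Ind[S] ('chi_0 - 'chi_i)] adds to it ['chi_a] minus its conjugate; so [u] is
    invariant under conjugation except at [a] and its conjugate. *)
Lemma conj_shift (gT : finGroupType) (S P : {group gT}) (i : Iirr P) (a : Iirr S)
    (u : Iirr S -> int) : exceptional i a ->
  (forall c, '['Ind[S] ('chi_0 - 'chi_i), 'chi_c] = (u c)%:~R) ->
  forall c, u (conjC_Iirr c) = u c + (c == a)%:R - (c == conjC_Iirr a)%:R.
Proof.
move=> [Ea na] Eu c; apply: (@intr_inj algC); rewrite rmorphB rmorphD /= -!Eu !rmorph_nat.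
rewrite conjC_IirrE cfdot_conjCr cfAutInd rmorphB /= irr0 rmorph1 -irr0 -conjC_IirrE.
have -> : '['Ind[S] ('chi_0 - 'chi_(conjC_Iirr i)), 'chi_c] =
  '['Ind[S] ('chi_0 - 'chi_i), 'chi_c] + (c == a)%:R - (c == conjC_Iirr a)%:R.
  have Ed : '['Ind[S] ('chi_i - 'chi_(conjC_Iirr i)), 'chi_c] =
      (c == a)%:R - (c == conjC_Iirr a)%:R.
    by rewrite Ea cfdotBl !cfdot_irr ![_ == c]eq_sym.
  by rewrite -addrA -Ed -cfdotDl -linearD /= addrA subrK.
by rewrite Eu !(rmorphB, rmorphD) /= !rmorph_nat rmorph_int.
Qed.

(* In a group of odd order the nontrivial irreducible characters come in conjugate
   pairs, so modulo 2 only the trivial character contributes to the scalar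
   product of the two induced characters. *)
Lemma exceptional_parity (gT : finGroupType) (S P1 P2 : {group gT})
    (i : Iirr P1) (j : Iirr P2) (a b : Iirr S) (u v : Iirr S -> int) :
  odd #|S| -> i != 0 -> j != 0 -> P1 \subset S -> P2 \subset S ->
  exceptional i a -> exceptional j b ->
  '['Ind[S] ('chi_i - 'chi_(conjC_Iirr i)), 'Ind[S] ('chi_j - 'chi_(conjC_Iirr j))] = 0 ->
  '['Ind[S] ('chi_0 - 'chi_i), 'Ind[S] ('chi_0 - 'chi_j)] = 0 ->
  (forall c, '['Ind[S] ('chi_0 - 'chi_i), 'chi_c] = (u c)%:~R) ->
  (forall c, '['Ind[S] ('chi_0 - 'chi_j), 'chi_c] = (v c)%:~R) ->
  (2 %| v a)%Z -> (2 %| u b)%Z -> False.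
Proof.
move=> oS ni nj sP1 sP2 exa exb ab0 E0 Eu Ev va ub.
have uc := conj_shift exa Eu; have vc := conj_shift exb Ev.
have one (P : {group gT}) (k : Iirr P) (w : Iirr S -> int) :
    P \subset S -> k != 0 ->
    (forall c, '['Ind[S] ('chi_0 - 'chi_k), 'chi_c] = (w c)%:~R) -> w 0 = 1.
  move=> sP nk Ew; apply: (@intr_inj algC); rewrite -Ew -cfdot_Res_r.
  have -> : 'Res[P, S] 'chi_0 = 'chi_0 by rewrite !irr0 cfRes_cfun1.
  by rewrite cfdotBl !cfdot_irr (negPf nk) subr0.
have sum0 : \sum_c u c * v c = 0.
  apply: (@intr_inj algC); rewrite rmorph_sum /= -[RHS]E0 cfdot_sum_irr.
  by apply: eq_bigr => c _; rewrite Eu Ev rmorphM /= rmorph_int.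
have [_ na] := exa; have [_ nb] := exb.
have nab : (a != b) && (a != conjC_Iirr b).
  apply/andP; split; apply/eqP=> Eab; have [Ea _] := exa; have [Eb _] := exb;
  move: ab0; rewrite Ea Eb Eab ?conjC_IirrK cfdotBl !cfdotBr !cfdot_irr !eqxx;
  rewrite ?(negPf nb) ?[b == _]eq_sym ?(negPf nb) ?subr0 ?sub0r ?opprK ?addr0 => /eqP.
    by rewrite -(natrD _ 1) pnatr_eq0.
  by rewrite -opprD oppr_eq0 -(natrD _ 1) pnatr_eq0.
(* A conjugate pair contributes twice a product, up to a correction by a value of [v] on the pair of
   [a], or of [u] on the pair of [b]. The two pairs are disjoint, so these values are even by
   assumption. *)
have par c : c != 0 -> (2 %| u c * v c + u (conjC_Iirr c) * v (conjC_Iirr c))%Z.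
  have [/negPf nab1 /negPf nab2] := andP nab.
  have nab3 : (conjC_Iirr a == b) = false.
    by rewrite -nab2 -(inj_eq (inv_inj (@conjC_IirrK _ S))) conjC_IirrK.
  have nab4 : (conjC_Iirr a == conjC_Iirr b) = false.
    by rewrite (inj_eq (inv_inj (@conjC_IirrK _ S))).
  have va' : (2 %| v (conjC_Iirr a))%Z by rewrite vc nab1 nab2 subr0 addr0.
  have ub' : (2 %| u (conjC_Iirr b))%Z.
    by rewrite uc (eq_sym b a) nab1 (eq_sym b) nab3 subr0 addr0.
  move=> nc; rewrite uc vc.
  have two (x y : int) : (2 %| x * y + x * y)%Z.
    have -> : x * y + x * y = 2 * (x * y) by ring.
    exact: dvdz_mulr.
  have fin (x y e : int) : (2 %| e)%Z -> (2 %| x * y + x * y + e)%Z.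
    by move=> de; rewrite rpredD.
  have aa : (a == conjC_Iirr a) = false by rewrite eq_sym (negPf na).
  have bb : (b == conjC_Iirr b) = false by rewrite eq_sym (negPf nb).
  have [->|ca] := eqVneq c a.
    rewrite aa nab1 nab2 !mulr0n mulr1n.
    by have := fin (u a) (v a) _ va; congr (_ %| _)%Z; ring.
  have [->|ca'] := eqVneq c (conjC_Iirr a).
    rewrite nab3 nab4 !mulr0n mulr1n.
    have := fin (u (conjC_Iirr a)) (v (conjC_Iirr a)) (- v (conjC_Iirr a)).
    by rewrite rpredN => /(_ va'); congr (_ %| _)%Z; ring.
  have [->|cb] := eqVneq c b.
    rewrite bb !mulr0n mulr1n.
    by have := fin (u b) (v b) _ ub; congr (_ %| _)%Z; ring.
  have [->|cb'] := eqVneq c (conjC_Iirr b); last first.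
    rewrite !mulr0n.
    by have := fin (u c) (v c) 0 (dvdz0 2); congr (_ %| _)%Z; ring.
  rewrite !mulr0n mulr1n.
  have := fin (u (conjC_Iirr b)) (v (conjC_Iirr b)) (- u (conjC_Iirr b)).
  by rewrite rpredN => /(_ ub'); congr (_ %| _)%Z; ring.
move: sum0; rewrite (bigD1 0) //= (one _ _ _ sP1 ni Eu) (one _ _ _ sP2 nj Ev) mulr1.
rewrite (sum_fpf_involution _ (@conjC_IirrK _ S)) => [|c|c nc]; first last.
- exact: odd_irr_nonreal.
- by rewrite conjC_Iirr_eq0.
set R := \sum_(c | _) _ => /eqP; rewrite addr_eq0 => /eqP E1.
have : (2 %| - R)%Z.
  by rewrite rpredN rpred_sum // => c /andP[nc _]; apply: par.
by rewrite -E1.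
Qed.

End ExceptionalCharacters.

(** Here [h r] is the index of a Sylow [r]-subgroup, largest at [p], so the primes in [In] account
    for at most [(l p).-1 * (h p).-1] elements. Subtracting the norm bound from the partition leaves
    [h p * ((l p).-1 * (w p).-1) <= (l p).-1 * (h p).-1], absurd since [w p >= 2]. *)
Lemma odd_arith (g p : nat) (ps : seq nat) (A l n w : nat -> nat) (In : pred nat) :
  uniq ps -> p \in ps -> 0 < g ->
  {in ps, forall r, A r = (l r * w r).+1 /\ n r * (A r * l r) = g} ->
  {in ps, forall r, r != p -> A p < A r} -> 1 < w p -> 1 < l p ->
  g = 1 + \sum_(r <- ps) (A r).-1 * n r ->
  1 + l p * (A p - l p) * n p
    + \sum_(r <- ps | (r != p) && ~~ In r) (A r).-1 * n r <= g ->
  (\sum_(r <- ps | (r != p) && In r) w r).+1 <= l p -> False.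
Proof.
move=> ups pps g0 EA minA w2 l2 E1 E2 E3.
pose h r := n r * l r.
have Eh r : r \in ps -> A r * h r = g by move=> /EA[_ <-]; rewrite /h mulnCA mulnA mulnC.
have Ew r : r \in ps -> (A r).-1 * n r = w r * h r.
  by move=> /EA[-> _]; rewrite /h /= mulnC [w r * _]mulnC -mulnA.
have hlt r : r \in ps -> r != p -> h r <= (h p).-1.
  move=> rps nr; have := minA r rps nr; have := Eh r rps; have := Eh p pps.
  have hp : 0 < h p by move: g0; rewrite -(Eh p pps) muln_gt0 => /andP[].
  move=> Ep Er lt; rewrite -ltnS prednK // ltnNge; apply/negP => le.
  have : A p * h p < A r * h r.
    by apply: leq_trans (leq_mul (leqnn _) le); rewrite ltn_pmul2r.
  by rewrite Ep Er ltnn.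
have In_le : \sum_(r <- ps | (r != p) && In r) (A r).-1 * n r <= (l p).-1 * (h p).-1.
  apply: leq_trans (_ : \sum_(r <- ps | (r != p) && In r) w r * (h p).-1 <= _).
    rewrite big_seq_cond [leqRHS]big_seq_cond.
    by apply: leq_sum => r /and3P[rps nr _]; rewrite Ew // leq_mul2l hlt ?orbT.
  by rewrite -big_distrl leq_mul2r -ltnS prednK ?E3 ?orbT // ltnW.
move: E1; rewrite (bigD1_seq p) //= (bigID In) /= Ew //.
move: E2 In_le; set I := \sum_(_ <- _ | _) _; set O := \sum_(_ <- _ | _) _.
have -> : l p * (A p - l p) * n p = h p * (A p - l p) by rewrite /h; lia.
have [Ap _] := EA p pps; have := Eh p pps.
have h0 : 0 < h p by move: g0; rewrite -(Eh p pps) muln_gt0 => /andP[].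
have lA : l p <= A p by rewrite Ap; nia.
have -> : h p * (A p - l p) = h p * A p - h p * l p by rewrite mulnBr.
have : h p * l p <= h p * A p by rewrite leq_mul2l lA orbT.
rewrite Ap; move: (h p) (l p) (w p) w2 l2 h0 => H L W; clear.
case: W => [|[|W]] // _; case: L => [|L] // L2; case: H => // H _ /=; nia.
Qed.

Lemma seq_argmin (T : eqType) (f : T -> nat) (s : seq T) x0 : x0 \in s ->
  exists2 x, x \in s & {in s, forall y, f x <= f y}.
Proof.
elim: s x0 => // y s IHs x0 _; case: s IHs => [_|z s /(_ z (mem_head _ _))[x xs minx]].
  by exists y; rewrite ?mem_head // => z; rewrite inE => /eqP->.
have [le|lt] := leqP (f x) (f y).
  exists x; first by rewrite inE xs orbT.
  by move=> t; rewrite inE => /orP[/eqP->|/minx].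
exists y; first exact: mem_head.
by move=> t; rewrite inE => /orP[/eqP->|/minx /(leq_trans (ltnW lt))].
Qed.

Section OddOrder.
Import Order.TTheory GroupScope GRing.Theory Num.Theory.
Local Open Scope ring_scope.

Section ExcSet.
Variables (gT : finGroupType) (S N P : {group gT}).
Hypotheses (oddS : odd #|S|) (tiP : normedTI P^# S N) (abP : abelian P).
Hypotheses (nPN : P <| N) (frobN : [Frobenius N with kernel P]).

Definition exc_set (S P : {group gT}) : {set Iirr S} :=
  [set b | [exists j : Iirr P, (j != 0) &&
   (('Ind[S] ('chi_j - 'chi_(conjC_Iirr j)) == 'chi_b - 'chi_(conjC_Iirr b))
     && (conjC_Iirr b != b))]].

Lemma exc_setP (b : Iirr S) :
  reflect (exists2 j : Iirr P, j != 0 & exceptional j b) (b \in exc_set S P).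
Proof.
rewrite inE; apply: (iffP existsP) => [[j /and3P[nj /eqP E nb]] | [j nj [E nb]]].
  by exists j.
by exists j; rewrite nj E eqxx.
Qed.

(** Each [j != 0] has an exceptional character, and at most [#|N : P|] of them share it: if [j] and
    [j0] do, their induced differences have scalar product 2, which puts [j] in the orbit of
    [j0]. *)
Lemma card_exc_set : (#|P|.-1 <= #|exc_set S P| * #|N : P|)%N.
Proof.
have nz : #|[set j : Iirr P | j != 0]| = #|P|.-1.
  by rewrite -(card_Iirr_abelian abP) -(cardC1 (0 : Iirr P)); apply: eq_card => j; rewrite !inE.
have [f fP] : exists f : Iirr P -> Iirr S, forall j, j != 0 -> exceptional j (f j).
  apply: (@fin_all_exists _ (fun=> Iirr S) (fun j b => j != 0 -> exceptional j b)) => j.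
  have [->|nj] := eqVneq j 0; first by exists 0.
  by have [b ex] := TI_exc oddS tiP abP nPN frobN nj; exists b.
rewrite -nz -sum1_card (partition_big f (mem (exc_set S P))) /=; last first.
  by move=> j; rewrite inE => nj; apply/exc_setP; exists j; last exact: fP.
rewrite -sum_nat_const; apply: leq_sum => b _; rewrite sum1dep_card.
have [->|/set0Pn[j0]] := eqVneq [set j | (j \in [set j : Iirr P | j != 0]) && (f j == b)] set0.
  by rewrite cards0.
rewrite !inE => /andP[nj0 /eqP fj0]; rewrite -(card_Ind_class abP nPN frobN nj0).
apply: subset_leq_card; apply/subsetP=> j; rewrite !inE => /andP[nj /eqP fj].
rewrite nj /=.
have [E1 nb] := fP j nj; have [E2 _] := fP j0 nj0; rewrite fj in E1 nb; rewrite fj0 in E2.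
have nc k : k != 0 -> conjC_Iirr k != 0 :> Iirr P by rewrite conjC_Iirr_eq0.
have : '['Ind[S] ('chi_j - 'chi_(conjC_Iirr j)),
         'Ind[S] ('chi_j0 - 'chi_(conjC_Iirr j0))] = 2.
  rewrite E1 E2 cfnormBd ?cfnorm_irr // cfdot_irr eq_sym (negPf nb) //.
rewrite (TI_isom tiP nPN) ?sub_irr_on // !linearB /= cfdotBl !cfdotBr.
rewrite !(TI_Ind_dot frobN) ?nc //.
have Ec k : 'Ind[N] 'chi_(conjC_Iirr k) = ('Ind[N] 'chi[P]_k)^*%CF.
  by rewrite conjC_IirrE -cfAutInd.
case: eqP => // nE; have -> : ('Ind[N] 'chi_(conjC_Iirr j) == 'Ind[N] 'chi_(conjC_Iirr j0)) = false.
  by apply/eqP; rewrite !Ec => /(congr1 (fun f => f^*%CF)); rewrite !cfConjCK.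
rewrite sub0r subr0 -opprD -natrD => /eqP; rewrite eq_sym -addr_eq0 -natrD.
by rewrite pnatr_eq0.
Qed.

Lemma exc_set0 : 0 \notin exc_set S P.
Proof. by apply/exc_setP => -[j _ [_]]; rewrite conjC_Iirr0 eqxx. Qed.

End ExcSet.

Section Odd.
Variables (gT : finGroupType) (S : {group gT}).
Hypotheses (simS : simple S) (nabS : ~~ abelian S).
Hypothesis ab2S :
  forall H K : {group gT}, H \proper S -> K \proper H -> abelian K.
Hypothesis oddS : odd #|S|.
Local Notation syl := (syl S).
Local Notation sylN := (sylN S).
Local Notation sylI := (sylI S).
Local Notation sylP := (sylP S).

Let tiP p : p \in \pi(S) -> normedTI (syl p)^# S (sylN p).
Proof. by move=> pS; apply: Sylow_normedTI (sylP p) (syl_nt pS). Qed.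

Let abP p : abelian (syl p).
Proof. exact: Sylow_abelian simS nabS ab2S _ _ (sylP p). Qed.

Let sPS p : syl p \subset S. Proof. exact: pHall_sub (sylP p). Qed.

Let nPN p : syl p <| sylN p.
Proof. by rewrite /normal subsetI sPS normG subsetIr. Qed.

Let frobN p : p \in \pi(S) -> [Frobenius sylN p with kernel syl p].
Proof.
move=> pS; have [Q [[_ _ _ _ fr] _]] := sylN_frob simS nabS ab2S pS.
exact: FrobeniusWker fr.
Qed.

Let disj p r : p \in \pi(S) -> r \in \pi(S) -> p != r ->
  [disjoint class_support (syl p)^# S & class_support (syl r)^# S].
Proof.
move=> pS rS npr; rewrite !class_support_syl // -setI_eq0 -subset0.
apply/subsetP=> x; rewrite !inE => /andP[/andP[/andP[nx _] px] /andP[_ rx]].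
case/negP: nx; rewrite -order_eq1; have := pnat_coprime px (_ : p^'.-nat #[x]%g).
rewrite /coprime gcdnn; apply; apply: sub_in_pnat rx => y _.
by rewrite !inE => /eqP->; rewrite eq_sym.
Qed.

Let exc_disj p r b : p \in \pi(S) -> r \in \pi(S) -> p != r ->
  b \in exc_set S (syl p) -> b \in exc_set S (syl r) -> False.
Proof.
move=> pS rS npr /exc_setP[i ni [Ei nb]] /exc_setP[j nj [Ej _]].
have := Ind_ortho (sPS p) (tiP rS) (nPN r) (disj pS rS npr)
  (sub_irr_on i (conjC_Iirr i) (abP p)) (sub_irr_on j (conjC_Iirr j) (abP r)).
rewrite Ei Ej cfnormBd; last by rewrite cfdot_irr eq_sym (negPf nb).
rewrite !cfnorm_irr.
by move/eqP; rewrite -mulr2n pnatr_eq0.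
Qed.

(* Take p with the smallest Sylow subgroup and let [a] be an exceptional character
   for it.  On the Sylow r-subgroups, r != p, [a] is a constant integer; [Out] are
   the primes where it is nonzero, and the norm of [a] bounds their contribution.
   For the other primes, parity puts the exceptional characters into the
   support of Ind(1 - lambda), whose norm is |N(P) : P| + 1. *)
Lemma odd_contra : False.
Proof.
have ntS : S :!=: 1%g := simple_nt nabS.
have : pdiv #|S| \in \pi(S) by rewrite pi_pdiv cardG_gt1.
case/(seq_argmin (fun p => #|syl p|)) => p pS minp.
have {}minp r : r \in \pi(S) -> r != p -> (#|syl p| < #|syl r|)%N.
  move=> rS nrp; rewrite ltn_neqAle minp // andbT; apply/eqP => E.
  have : coprime #|syl p| #|syl r|.
    rewrite (card_Hall (sylP p)) (card_Hall (sylP r)).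
    have [pp pr] : prime p /\ prime r.
      by move: pS rS; rewrite !mem_primes => /andP[-> _] /andP[-> _].
    by rewrite !p_part coprimeXl // coprimeXr // prime_coprime // dvdn_prime2 // eq_sym.
  rewrite -E /coprime gcdnn -trivg_card1.
  by rewrite (negPf (syl_nt pS)).
have lP r : r \in \pi(S) -> exists w, (#|syl r| = (sylI r * w).+1 /\
    #|S : sylN r| * (#|syl r| * sylI r) = #|S|)%N.
  move=> rS; have /dvdnP[w Ew] := Frobenius_ker_dvd_ker1 (frobN rS).
  exists w; split; last exact: sylN_index.
  by rewrite mulnC -Ew prednK.
have [w Hw] : exists w : nat -> nat, {in \pi(S), forall r, #|syl r| = (sylI r * w r).+1 /\
    #|S : sylN r| * (#|syl r| * sylI r) = #|S|}%N.
  exists (fun r => #|syl r|.-1 %/ sylI r)%N => r rS; have [v [E1 E2]] := lP r rS.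
  split=> //; have l0 : (0 < sylI r)%N by rewrite indexg_gt0.
  by rewrite {2}E1 /= mulKn.
have [i ni] : exists i : Iirr (syl p), i != 0.
  have : (0 < #|predC1 (0%R : Iirr (syl p))|)%N.
    by rewrite cardC1 card_Iirr_abelian // -subn1 subn_gt0 cardG_gt1 syl_nt.
  by case/card_gt0P=> i; rewrite inE; exists i.
have nci : conjC_Iirr i != 0 by rewrite conjC_Iirr_eq0.
have [a exa] := TI_exc oddS (tiP pS) (abP p) (nPN p) (frobN pS) ni.
have [Ea na] := exa.
have intI r (j k : Iirr (syl r)) c :
    exists z : int, '['Ind[S] ('chi_j - 'chi_k), 'chi_c] = z%:~R.
  have : 'Ind[S] ('chi_j - 'chi_k) \in 'Z[irr S].
    by rewrite cfInd_vchar // rpredB ?irr_vchar.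
  by move/(Cint_cfdot_vchar_irr c)/intrP.
have [u Eu] : exists u : Iirr S -> int,
    forall c, '['Ind[S] ('chi_0 - 'chi_i), 'chi_c] = (u c)%:~R.
  by have [u] := fin_all_exists (intI p 0 i); exists u.
pose Out r := [forall x in (syl r)^#, 1 <= `|'chi_a x| ^+ 2].
have InP r b : r \in \pi(S) -> r != p -> ~~ Out r -> b \in exc_set S (syl r) ->
    u b != 0.
  move=> rS nrp nO /exc_setP[j nj exb]; apply/eqP => ub.
  have npr : p != r by rewrite eq_sym.
  have [v Ev] : exists v : Iirr S -> int,
      forall c, '['Ind[S] ('chi_0 - 'chi_j), 'chi_c] = (v c)%:~R.
    by have [v] := fin_all_exists (intI r 0 j); exists v.
  have val x : x \in (syl r)^# -> 'chi_a x = (v a)%:~R.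
    move=> Px; rewrite (exceptional_val (sPS p) (abP p) (tiP rS) (abP r) (nPN r)
                          (frobN rS) (disj pS rS npr) exa nj Px).
    by rewrite cfdotC Ev conj_Creal // realz.
  have va : v a = 0.
    apply: contraNeq nO => nv; apply/forall_inP=> x /val->.
    rewrite -intr_norm -rmorphXn /= ler1z expr_ge1 ?normr_ge0 //.
    by rewrite -gtz0_ge1 normr_gt0.
  apply: (@exceptional_parity _ S (syl p) (syl r) i j a b u v) => //.
  - by apply: (Ind_ortho (sPS p) (tiP rS) (nPN r) (disj pS rS npr)); rewrite ?sub_irr_on.
  - by apply: (Ind_ortho (sPS p) (tiP rS) (nPN r) (disj pS rS npr)); rewrite ?sub_irr_on.
  - by rewrite va dvdz0.
  - by rewrite ub dvdz0.
have u0 : u 0 != 0.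
  apply/eqP => u0; have := Eu 0; rewrite u0 -cfdot_Res_r.
  have -> : 'Res[syl p, S] 'chi_0 = 'chi_0 by rewrite !irr0 cfRes_cfun1.
  by rewrite cfdotBl !cfdot_irr (negPf ni) subr0 => /eqP; rewrite oner_eq0.
(* By [conj_shift], the values of [u] at [a] and at its conjugate differ by 1, so one is nonzero. *)
have [a' [a'u a'ex]] : exists a', u a' != 0 /\ a' \in exc_set S (syl p).
  have [ua|ua] := eqVneq (u a) 0; last first.
    by exists a; split=> //; apply/exc_setP; exists i.
  exists (conjC_Iirr a); split.
    by rewrite (conj_shift exa Eu) ua eqxx (eq_sym a) (negPf na).
  apply/exc_setP; exists (conjC_Iirr i) => //; split; rewrite !conjC_IirrK.
    by rewrite -opprB linearN /= Ea opprB.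
  by rewrite eq_sym.
pose ps := primes #|S|.
pose In r := ~~ Out r.
have norm_u : (#|[set c | u c != 0]| <= (sylI p).+1)%N.
  rewrite -(ler_nat algC) -(TI_norm1 (tiP pS) (abP p) (nPN p) (frobN pS) ni).
  rewrite cfdot_sum_irr -sum1_card natr_sum big_mkcond /=.
  apply: ler_sum => c _; rewrite inE Eu; case: ifP => [nu|_]; last exact: mul_conjC_ge0.
  rewrite conj_Creal ?realz // -expr2 -rmorphXn /= ler1z -real_normK ?num_real //.
  by rewrite expr_ge1 ?normr_ge0 // -gtz0_ge1 normr_gt0.
(* The exceptional sets of different primes are disjoint and avoid [0]. Those of the primes in [In],
   with at least [w r] elements each, together with [0] and [a'], lie in the support of [u], which
   has at most [(sylI p).+1] elements. *)
have sumIn : (\sum_(r <- ps | (r != p) && In r) w r < sylI p)%N.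
  have le_w r : r \in ps -> (w r <= #|exc_set S (syl r)|)%N.
    move=> rS; have := card_exc_set oddS (tiP rS) (abP r) (nPN r) (frobN rS).
    by have [-> _] := Hw r rS; rewrite /= mulnC leq_pmul2r // indexg_gt0.
  rewrite -ltnS; apply: leq_trans norm_u.
  apply: leq_trans (_ : (\sum_(r <- ps | (r != p) && In r) #|exc_set S (syl r)|).+2 <= _)%N.
    rewrite !ltnS big_seq_cond [leqRHS]big_seq_cond.
    by apply: leq_sum => r /andP[rS _]; apply: le_w.
  have sum1 (x : Iirr S) : (\sum_c (c == x) = 1)%N.
    by rewrite (bigD1 x) //= eqxx big1 // => c /negPf->.
  rewrite -[X in (X <= _)%N]add2n -[2%N]/(1 + 1)%N -{1}(sum1 0) -(sum1 a').
  rewrite (eq_bigr (fun r => \sum_c (c \in exc_set S (syl r)))%N); last first.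
    by move=> r _; rewrite -sum1_card big_mkcond /=; apply: eq_bigr => c _; case: (c \in _).
  rewrite exchange_big /= -!big_split -sum1_card [leqRHS]big_mkcond /=.
  apply: leq_sum => c _; rewrite inE.
  have [->|nc0] := eqVneq c 0.
    rewrite u0 eq_sym (_ : (a' == 0) = false) ?big1 // => [r _|].
      by rewrite (negPf (exc_set0 _ _)).
    by apply: contraTF a'ex => /eqP->; rewrite exc_set0.
  have [->|nca] := eqVneq c a'.
    rewrite a'u big1_seq // => r /andP[/andP[nrp _] rS].
    by apply/eqP; rewrite eqb0; apply/negP; apply: exc_disj a'ex => //; rewrite eq_sym.
  have [/hasP[r rS /andP[/andP[nrp Ir] cr]]|no] :=
      boolP (has (fun r => (r != p) && In r && (c \in exc_set S (syl r))) ps).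
    rewrite (InP r c rS nrp Ir cr) big_mkcond (bigD1_seq r) ?primes_uniq //=.
    rewrite nrp Ir cr big1_seq // => s /andP[nsr sS]; case: ifP => // _.
    apply/eqP; rewrite eqb0; apply/negP => cs.
    by apply: exc_disj sS rS nsr cs cr.
  rewrite big1_seq // => r /andP[Pr rS]; apply/eqP; rewrite eqb0.
  by apply: contra no => cr; apply/hasP; exists r => //; rewrite Pr.
have p_ps : p \in ps by [].
have oI r : r \in \pi(S) -> odd (sylI r).
  by move=> rS; apply: dvdn_odd oddS; rewrite -(sylN_index rS) !dvdn_mull.
have l1 : (1 < sylI p)%N.
  by have [Q [[_ pl _ _ _] _]] := sylN_frob simS nabS ab2S pS; apply: prime_gt1.
(* [sylI p * w p] is even and positive while [sylI p] is odd, so [w p] is even and positive. *)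
have w1 : (1 < w p)%N.
  have [E _] := Hw p pS.
  have oA : odd #|syl p| by apply: dvdn_odd oddS; apply: cardSg.
  have A1 : (1 < #|syl p|)%N by rewrite cardG_gt1 syl_nt.
  move: oA A1; rewrite E /= oddM oI //=.
  by case: (w p) => [|[|]] //; rewrite muln0.
apply: (@odd_arith #|S| p ps (fun r => #|syl r|) sylI (fun r => #|S : sylN r|) w In) => //.
- exact: primes_uniq.
- exact: card_partition simS nabS ab2S.
rewrite -(ler_nat algC).
have -> : #|S|%:R = \sum_(x in S) `|'chi_a x| ^+ 2.
  have := cfnorm_irr a; rewrite cfdotE => /(canRL (mulVKf (neq0CG S))).
  by rewrite mulr1 => <-; apply: eq_bigr => x _; rewrite normCK.
rewrite (big_setD1 1%g) //= (big_elts simS nabS ab2S) (bigD1_seq p) ?primes_uniq //=.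
have invF x g : g \in S -> `|'chi_a (x ^ g)%g| ^+ 2 = `|'chi_a x| ^+ 2.
  by move=> Sg; rewrite cfunJ.
rewrite !natrD -addrA; apply: lerD.
  have /natrP[d Ed] := Cnat_irr1 a; have := irr1_gt0 a; rewrite Ed ltr0n => d0.
  by rewrite normr_nat -natrX ler_nat expn_gt0 d0.
apply: lerD.
  rewrite -class_support_syl // (normedTI_sum (tiP pS) invF) -[leRHS]mulr_natr natrM.
  rewrite ler_wpM2r ?ler0n //.
  exact: exceptional_norm_lb oddS (tiP pS) (abP p) (nPN p) (frobN pS) _ _ ni exa.
rewrite natr_sum [leRHS](bigID In) /= -[leLHS]add0r; apply: lerD.
  by apply: sumr_ge0 => r _; apply: sumr_ge0 => x _; rewrite exprn_ge0.
rewrite big_seq_cond [leRHS]big_seq_cond; apply: ler_sum => r /and3P[rS nrp nI].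
rewrite -class_support_syl // (normedTI_sum (tiP rS) invF) -[leRHS]mulr_natr natrM.
rewrite ler_wpM2r ?ler0n //.
have -> : #|syl r|.-1 = #|(syl r)^#| by rewrite (cardsD1 1%g (syl r)) group1.
rewrite -sum1_card natr_sum; apply: ler_sum => x Px.
by move: nI; rewrite negbK => /forall_inP; apply.
Qed.
End Odd.

End OddOrder.

(** * Identification of the alternating group *)

Section Identification.
Import GroupScope.

Lemma card_Alt5 : #|'Alt_('I_5)| = 60.
Proof.
have : 1 < #|'I_5| by rewrite card_ord.
by move/card_Alt; rewrite card_ord => /eqP; rewrite -[5`!]/(2 * 60)%N eqn_pmul2l // => /eqP.
Qed.

Lemma simple_coset_action (gT : finGroupType) (S N : {group gT}) n :
  simple S -> N \proper S -> #|S : N| = n ->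
  exists f : {morphism S >-> {perm 'I_n}}, 'injm f.
Proof.
move=> simS prN <-; have [sNS _] := andP prN.
pose X := rcosets N S.
have act_in (i : 'I_#|X|) x : x \in S -> enum_val i :* x \in X.
  move=> Sx; have /rcosetsP[y Sy ->] := enum_valP i.
  by rewrite -rcosetM -rcosetE imset_f ?groupM.
(* The identity outside [S], so that [f x] is a permutation for every [x]. *)
pose g x (i : 'I_#|X|) := if x \in S then enum_rank_in (enum_valP i) (enum_val i :* x) else i.
have gE x i : x \in S -> enum_val (g x i) = enum_val i :* x.
  by move=> Sx; rewrite /g Sx enum_rankK_in ?act_in.
have g_inj x : injective (g x).
  have [Sx|nSx] := boolP (x \in S); last by rewrite /g (negPf nSx).
  move=> i j /(congr1 (@enum_val _ X)); rewrite !gE // => /rcoset_inj.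
  exact: enum_val_inj.
pose f x : {perm 'I_#|X|} := perm (@g_inj x).
have fM : {in S &, {morph f : x y / x * y}}.
  move=> x y Sx Sy; apply/permP=> i; rewrite permM !permE; apply: enum_val_inj.
  by rewrite !gE ?groupM // rcosetM.
exists (Morphism fM); have /simpleP[_ /(_ _ (ker_normal (Morphism fM)))] := simS.
case=> [->//|kS]; case/negP: (proper_subn prN).
apply/subsetP=> x Sx; have : x \in 'ker (Morphism fM) by rewrite kS.
move/mker => /= fx1.
have XN : gval N \in X by rewrite -[gval N]rcoset1 -rcosetE imset_f ?group1.
have /permP/(_ (enum_rank_in XN (gval N)))/(congr1 (@enum_val _ X)) := fx1.
rewrite permE gE // perm1 enum_rankK_in // => E.
by rewrite -E rcoset_refl.
Qed.

Lemma simple_ab2_Alt5 (gT : finGroupType) (S : {group gT}) :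
  simple S -> ~~ abelian S ->
  (forall H K : {group gT}, H \proper S -> K \proper H -> abelian K) ->
  S \isog 'Alt_('I_5).
Proof.
move=> simS nabS ab2S.
have evS : 2 \in \pi(S).
  rewrite mem_primes cardG_gt0 /= dvdn2; apply/negP => oS.
  exact: odd_contra simS nabS ab2S oS.
have [oS iN] := even_card simS nabS ab2S evS.
have prN := sylN_proper simS nabS evS.
have [f injf] := simple_coset_action simS prN iN.
have fA : f @* S = 'Alt_('I_5).
  apply/eqP; rewrite eqEcard card_injm // oS card_Alt5 leqnn andbT.
  have simT : simple (f @* S) by rewrite -(isog_simple (sub_isog (subxx S) injf)).
  have nT : f @* S :&: 'Alt_('I_5) <| f @* S.
    rewrite /normal subsetIl normsI ?normG //.
    exact: subset_trans (subsetT _) (Alt_norm _).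
  have /simpleP[_ /(_ _ nT)[T1|/setIidPl->//]] := simT.
  (* If the image had no nontrivial even permutation, the sign would embed it in a group of order
     2. *)
  have : #|f @* S : 'Alt_('I_5)| <= 2.
    have := card_morphim [morphism of @odd_perm 'I_5] (f @* S).
    rewrite setTI => <-; apply: leq_trans (max_card _) _.
    by rewrite card_bool.
  by rewrite -indexgI T1 indexg1 card_injm // oS.
by apply/isogP; exists f.
Qed.

End Identification.

(** * Infinite groups *)

Section InfiniteReduction.
Import GroupScope.

Section Subgroups.
Variable G : groupType.
Implicit Types H K A : set G.

Lemma subgroupV H x : subgroup H -> H x -> H x^-1.
Proof. by case=> H1 HF Hx; rewrite -[x^-1]mul1g; apply: HF. Qed.

Lemma subgroupM H x y : subgroup H -> H x -> H y -> H (x * y).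
Proof.
by move=> sH Hx Hy; rewrite -[y]invgK; case: (sH) => _; apply=> //; apply: subgroupV.
Qed.

Lemma subgroupJ H x y : subgroup H -> H x -> H y -> H (x ^ y).
Proof.
move=> sH Hx Hy; rewrite conjgE; apply: subgroupM => //; first exact: subgroupV.
exact: subgroupM.
Qed.

Lemma subgroupR H x y : subgroup H -> H x -> H y -> H [~ x, y].
Proof.
move=> sH Hx Hy; rewrite commgEl; apply: subgroupM => //; first exact: subgroupV.
exact: subgroupJ.
Qed.

Lemma subgroup_intro H : H 1 -> (forall x y, H x -> H y -> H (x * y)) ->
  (forall x, H x -> H x^-1) -> subgroup H.
Proof. by move=> H1 HM HV; split=> // x y Hx Hy; apply: HM => //; apply: HV. Qed.

Lemma subgroupT : subgroup [set: G]%classic.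
Proof. by []. Qed.

Lemma subgroup_generated A : subgroup (Defs.generated A).
Proof.
split=> [X [[X1 _] _] //|x y Hx Hy X [sX AX]].
by case: (sX) => _; apply; [apply: Hx|apply: Hy].
Qed.

Lemma sub_generated A x : A x -> Defs.generated A x.
Proof. by move=> Ax X [_]; apply. Qed.

Lemma generated_ind A H : subgroup H -> (forall x, A x -> H x) ->
  forall x, Defs.generated A x -> H x.
Proof. by move=> sH AH x; apply; split. Qed.

Lemma generated_commute A : (forall x y, A x -> A y -> commute x y) ->
  abelian_subgroup (Defs.generated A).
Proof.
have cent (B : set G) : subgroup (fun x => forall y, B y -> commute x y).
  apply: subgroup_intro => [y _|x x' Cx Cx' y By|x Cx y By].
  - exact/commute_sym/commute1.
  - by apply/commute_sym/commuteM; apply/commute_sym; [apply: Cx|apply: Cx'].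
  - by apply/commute_sym/commuteV/commute_sym/Cx.
move=> cA x y Gx Gy.
have Ay z : A z -> commute z y.
  move=> Az; apply/commute_sym.
  by apply: (generated_ind (cent [set z]%classic) _ Gy) => // u Au _ ->; apply: cA.
by apply: (generated_ind (cent [set y]%classic) _ Gx) => // u Au _ ->; apply: Ay.
Qed.

(** Pointwise, so that it passes to smaller sets and its negation supplies four elements. *)
Definition metab H :=
  forall x y z w, H x -> H y -> H z -> H w -> commute [~ x, y] [~ z, w].

Lemma subgroup_derived H : subgroup (derived_subgroup H).
Proof. exact: subgroup_generated. Qed.

Lemma derived_ind H K : subgroup K -> (forall x y, H x -> H y -> K [~ x, y]) ->
  forall x, derived_subgroup H x -> K x.
Proof.
move=> sK KR; apply: generated_ind => // _ [x Hx [y Hy <-]]; exact: KR.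
Qed.

Lemma metab_sol H : subgroup H -> metab H ->
  derived_subgroup (derived_subgroup H) = [set 1]%classic.
Proof.
move=> sH mH; have abD : abelian_subgroup (derived_subgroup H).
  by apply: generated_commute => _ _ [x Hx [y Hy <-]] [z Hz [w Hw <-]]; apply: mH.
apply/seteqP; split=> x /=; last by move=> ->; case: (subgroup_derived (derived_subgroup H)).
apply: (@derived_ind _ [set 1]%classic) => [|y z Dy Dz].
  by split=> // u v -> ->; rewrite invg1 mulg1.
by apply/eqP/commgP; apply: abD.
Qed.

Let derG n := iter n (@derived_subgroup G) [set: G]%classic.

Lemma subgroup_iter_derived n : subgroup (derG n).
Proof. by case: n => [|n]; [apply: subgroupT|apply: subgroup_derived]. Qed.

Lemma insoluble_iter_derived n : ~ soluble G -> ~ metab (derG n).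
Proof.
move=> insG mD; apply: insG; exists n.+2; rewrite /= metab_sol //.
exact: subgroup_iter_derived.
Qed.

(** * Quotients with all subgroups normal, as congruences modulo [H] *)

Section Dedekind.
Variable H : set G.
Hypotheses (sH : subgroup H).
Hypothesis nH : forall K, subgroup K -> (forall x, H x -> K x) -> normal_subgroup K.

Let eqH x y := H (x^-1 * y).
Let HJ x g : H x -> H (x ^ g). Proof. exact: (nH sH). Qed.

Let eqHxx x : eqH x x. Proof. by rewrite /eqH mulVg; case: sH. Qed.
Let eqHC x y : eqH x y -> eqH y x.
Proof. by move=> /(subgroupV sH); rewrite /eqH invMg invgK. Qed.
Let eqHT y x z : eqH x y -> eqH y z -> eqH x z.
Proof. by move=> xy /(subgroupM sH xy); rewrite /eqH mulgA mulgK. Qed.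
Let eqHM x y x' y' : eqH x x' -> eqH y y' -> eqH (x * y) (x' * y').
Proof.
move=> xx /(subgroupM sH (HJ y xx)); rewrite /eqH conjgE invMg.
by rewrite !mulgA mulgK.
Qed.
Let eqHV x y : eqH x y -> eqH x^-1 y^-1.
Proof.
move=> /(subgroupV sH)/(HJ y^-1); rewrite /eqH conjgE invMg !invgK.
by rewrite !mulgA mulgV mul1g.
Qed.
Let eqHJ x y g : eqH x y -> eqH (x ^ g) (y ^ g).
Proof. by move=> /(HJ g); rewrite /eqH conjMg conjVg. Qed.

(** Integer powers: the exponent is a sign, [true] for negative, and an absolute value. *)
Let zp (a : bool * nat) (x : G) := if a.1 then x ^- a.2 else x ^+ a.2.

Let eqHX a x y : eqH x y -> eqH (zp a x) (zp a y).
Proof.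
case: a => s n xy; have en : eqH (x ^+ n) (y ^+ n).
  by elim: n => [|n IHn]; rewrite ?expg0 // !expgS; apply: eqHM.
by case: s => //=; apply: eqHV.
Qed.

Let zpC a b x : zp a (zp b x) = zp b (zp a x).
Proof.
case: a b => [[] n] [[] m]; rewrite /zp /=;
by rewrite ?expVgn ?invgK -!expgnA mulnC.
Qed.

Let zpJ a x g : zp a x ^ g = zp a (x ^ g).
Proof. by case: a => [[] n]; rewrite /zp /= ?conjVg conjXg. Qed.

(* Modulo H every subgroup is normal, so g acts on cyclic subgroups by powers, and
   powers commute with each other: G/H is metabelian. *)
Lemma dedekind_conj x g : exists a, eqH (x ^ g) (zp a x).
Proof.
(* The preimage of the cyclic subgroup generated by [x] modulo [H]; it contains [H], so it is
   normal. *)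
pose K u := exists a, eqH u (zp a x).
have HK u : H u -> K u.
  by move=> Hu; exists (false, 0%N); rewrite /eqH /zp /= mulg1; apply: subgroupV.
suff sK : subgroup K.
  by apply: (nH sK HK); exists (false, 1%N); rewrite /zp /= expg1; apply: eqHxx.
apply: subgroup_intro => [|u v [a Ha] [b Hb]|u [a Ha]].
- by apply: HK; case: sH.
- have [c Hc] : exists c, zp a x * zp b x = zp c x.
    have mix n m : exists c, x ^+ n * x ^- m = zp c x.
      have [le|/ltnW le] := leqP m n.
        by exists (false, (n - m)%N); rewrite /zp /= expgnFr.
      exists (true, (m - n)%N); rewrite /zp /= expgnFr //.
      by rewrite invMg invgK.
    case: a b {Ha Hb} => [[] n] [[] m]; rewrite /zp /=.
    - by exists (true, (m + n)%N); rewrite /zp /= expgnDr invMg.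
    - have [c Hc] := mix m n; exists c; apply: etrans Hc.
      by apply/commute_sym/commuteV/commuteX2.
    - exact: mix.
    - by exists (false, (n + m)%N); rewrite /zp /= expgnDr.
  by exists c; rewrite -Hc; apply: eqHM.
- exists (~~ a.1, a.2); move/eqHV: Ha; congr eqH.
  by rewrite /zp /=; case: a.1; rewrite ?invgK.
Qed.

(** Any two conjugations commute modulo [H], so the derived subgroup of [G] is central modulo
    [H]. *)
Lemma dedekind_derived2 z : derived_subgroup (derived_subgroup [set: G]%classic) z -> H z.
Proof.
have cent x g1 g2 : eqH (x ^ (g1 * g2)) (x ^ (g2 * g1)).
  have [a Ha] := dedekind_conj x g1; have [b Hb] := dedekind_conj x g2.
  rewrite !conjgM; apply: eqHT (eqHJ g2 Ha) _; rewrite zpJ.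
  apply: eqHT (eqHX a Hb) _; rewrite zpC; apply: eqHC.
  by apply: eqHT (eqHJ g1 Hb) _; rewrite zpJ; apply: eqHX.
pose C v := forall x, eqH (x ^ v) x.
have sC : subgroup C.
  apply: subgroup_intro => [y|v w Cv Cw y|v Cv y]; first by rewrite conjg1.
    by rewrite conjgM; apply: eqHT (Cw y); apply: eqHJ.
  by apply: eqHC; rewrite -{1}(conjgKV v y); apply: Cv.
have DC v : derived_subgroup [set: G]%classic v -> C v.
  apply: derived_ind => // a b _ _ y.
  have := cent y a^-1 b^-1; move/(eqHJ (a * b)); rewrite -!conjgM.
  rewrite -(invMg a b) mulVg conjg1 => h; apply: eqHT (_ : eqH (y ^ (a^-1 * b^-1 * (a * b))) y); last exact: h.
  by rewrite commgEl conjgE !mulgA.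
apply: derived_ind => // u v Du Dv.
by rewrite commgEl; apply: eqHC; apply: DC.
Qed.
End Dedekind.
End Subgroups.

(** * Finite quotients of a subgroup *)

Section Quotient.
Variable G : groupType.

(** [f] is total on [G] but constrained on [M] only, so [M] can stay a set. *)
Definition onto_hom (M : set G) (gT : finGroupType) (S : {group gT}) (f : G -> gT) :=
  [/\ forall x y, M x -> M y -> f (x * y) = f x * f y,
      forall x, M x -> f x \in S
    & forall s, s \in S -> exists2 x, M x & f x = s].

Section Hom.
Variables (M : set G) (gT : finGroupType) (S : {group gT}) (f : G -> gT).
Hypotheses (sM : subgroup M) (hf : onto_hom M S f).

Lemma onto_hom1 : f 1 = 1.
Proof.
have [fM _ _] := hf; have M1 : M 1 by case: sM.
by apply: (mulgI (f 1)); rewrite mulg1 -fM // mulg1.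
Qed.

Lemma onto_homV x : M x -> f x^-1 = (f x)^-1.
Proof.
move=> Mx; have [fM _ _] := hf; apply: (mulgI (f x)).
by rewrite mulgV -fM ?mulgV ?onto_hom1 //; apply: subgroupV.
Qed.

Lemma onto_homJ x y : M x -> M y -> f (x ^ y) = f x ^ f y.
Proof.
move=> Mx My; have [fM _ _] := hf; rewrite !conjgE !fM ?onto_homV //.
  exact: subgroupV.
exact: subgroupM.
Qed.

Lemma onto_homR x y : M x -> M y -> f [~ x, y] = [~ f x, f y].
Proof.
move=> Mx My; have [fM _ _] := hf.
rewrite !commgEl fM ?onto_homV ?onto_homJ //; first exact: subgroupV.
exact: subgroupJ.
Qed.

Definition hpreim (A : {set gT}) : set G := fun x => M x /\ f x \in A.

Lemma subgroup_hpreim (A : {group gT}) : subgroup (hpreim A).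
Proof.
have [fM _ _] := hf; apply: subgroup_intro => [|x y [Mx Ax] [My Ay]|x [Mx Ax]].
- by split; [case: sM | rewrite onto_hom1].
- by split; [apply: subgroupM | rewrite fM // groupM].
- by split; [apply: subgroupV | rewrite onto_homV // groupV].
Qed.

Lemma hpreim_proper (A B : {group gT}) : B \subset S -> A \proper B ->
  (hpreim A `<` hpreim B)%classic.
Proof.
move=> sBS /properP[sAB [b Bb nAb]]; split=> [x [Mx Ax]|h].
  by split=> //; apply: (subsetP sAB).
have [_ _ /(_ b (subsetP sBS b Bb))[x Mx fx]] := hf.
by case/negP: nAb; rewrite -fx; case: (h x) => //; split; rewrite ?fx.
Qed.

Lemma abelian_hpreim (A : {group gT}) : A \subset S ->
  abelian_subgroup (hpreim A) -> abelian A.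
Proof.
move=> sAS abA; have [fM _ fS] := hf; apply/centsP=> a Aa b Ab.
have [x Mx fx] := fS a (subsetP sAS a Aa); have [y My fy] := fS b (subsetP sAS b Ab).
by rewrite /commute -fx -fy -!fM // abA // /hpreim ?fx ?fy.
Qed.

Lemma normal_hpreim (A : {group gT}) : A \subset S ->
  normal_subgroup (hpreim A) -> A <| S.
Proof.
move=> sAS nA; have [fM _ fS] := hf; rewrite /normal sAS; apply/subsetP=> s Ss.
rewrite inE; apply/subsetP=> _ /imsetP[a Aa ->].
have [x Mx fx] := fS a (subsetP sAS a Aa); have [y My fy] := fS s Ss.
by rewrite -fx -fy -onto_homJ //; case: (nA x y) => //; split; rewrite ?fx.
Qed.
End Hom.

(** [M] permutes the finitely many left cosets of [K]; the image is nontrivial because [K] is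
    proper, and a maximal normal subgroup of it is factored out. *)
Lemma finite_simple_quotient (M K : set G) :
  subgroup M -> subgroup K -> (K `<` M)%classic -> finite_index K M ->
  exists (gT : finGroupType) (S : {group gT}) (f : G -> gT),
    simple S /\ onto_hom M S f.
Proof.
move=> sM sK [sKM nMK] /finite_seqP[s Es].
have {nMK}[x0 Mx0 nKx0] : exists2 x, M x & ~ K x.
  by apply: contrapT => h; apply: nMK => x Mx; apply: contrapT => nKx; apply: h; exists x.
pose C (x : G) : set G := [set x * k | k in K]%classic.
have inC x : M x -> C x \in s.
  move=> Mx; have : [set C x | x in M]%classic (C x) by exists x.
  by rewrite Es.
have outC c : c \in s -> exists2 x, M x & c = C x.
  by move=> cs; have : [set` s]%classic c by []; rewrite -Es => -[x Mx <-]; exists x.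
pose T : finType := seq_sub s.
pose mv (x : G) (c : set G) : set G := [set x * k | k in c]%classic.
have mvC x y : mv x (C y) = C (x * y).
  apply/seteqP; split=> [_ [_ [k Kk <-] <-]|_ [k Kk <-]].
    by exists k; rewrite ?mulgA.
  by exists (y * k); rewrite ?mulgA //; exists k.
have mv_in x (c : T) : M x -> mv x (ssval c) \in s.
  move=> Mx; have [y My ->] := outC _ (ssvalP c); rewrite mvC.
  by apply: inC; apply: subgroupM.
have mvM x y c : mv (x * y) c = mv x (mv y c).
  apply/seteqP; split=> [_ [k ck <-]|_ [_ [k ck <-] <-]].
    by exists (y * k); rewrite ?mulgA //; exists k.
  by exists k; rewrite ?mulgA.
have mv1 c : mv 1 c = c.
  by apply/seteqP; split=> [_ [k ck <-]|k ck]; [rewrite mul1g | exists k; rewrite ?mul1g].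
pose g x (c : T) : T := insubd c (mv x (ssval c)).
have gE x c : M x -> ssval (g x c) = mv x (ssval c).
  by move=> Mx; rewrite /g val_insubd mv_in.
have g_inj x : M x -> injective (g x).
  move=> Mx c d /(congr1 (@ssval _ _)); rewrite !gE // => E; apply: val_inj.
  by rewrite /= -[LHS]mv1 -[RHS]mv1 -(mulVg x) !mvM E.
pose h x : {perm T} := if pselect (M x) is left Mx then perm (g_inj x Mx) else 1.
have hE x c : M x -> ssval (h x c) = mv x (ssval c).
  by move=> Mx; rewrite /h; case: pselect => // Mx'; rewrite permE gE.
(* Permutations compose from left to right, so inversion turns the left action into a morphism. *)
pose f x := h x^-1.
have fM x y : M x -> M y -> f (x * y) = f x * f y.
  move=> Mx My; apply/permP=> c; apply: val_inj; rewrite permM /= /f.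
  have [Mx' My'] := (subgroupV sM Mx, subgroupV sM My).
  by rewrite invMg !hE ?mvM //; apply: subgroupM.
pose Q := [set q : {perm T} | `[< exists2 x, M x & f x = q >]].
have gQ : group_set Q.
  apply/group_setP; split=> [|_ _ /[!inE]/asboolP[x Mx <-] /asboolP[y My <-]].
    rewrite inE; apply/asboolP; exists 1; first by case: sM.
    apply/permP=> c; apply: val_inj.
    by rewrite /= hE invg1 ?mv1 ?perm1 //; case: sM.
  by apply/asboolP; exists (x * y); [apply: subgroupM | rewrite fM].
pose QG := Group gQ.
have Qf x : M x -> f x \in QG by move=> Mx; rewrite inE; apply/asboolP; exists x.
have ntQ : QG :!=: 1.
  apply/trivgPn; exists (f x0^-1); first by apply: Qf; apply: subgroupV.
  apply/eqP => fx1; apply: nKx0.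
  have M1 : M 1 by case: sM.
  have := congr1 (fun q : {perm T} => ssval (q (SeqSub (inC 1 M1)))) fx1.
  rewrite /f invgK hE // perm1 /= mvC mulg1 => E.
  have : C 1 x0 by rewrite -E; exists 1; rewrite ?mulg1 //; case: sK.
  by case=> k Kk <-; rewrite mul1g.
have [N maxN] := ex_maxnormal_ntrivg ntQ.
have /andP[prN nN] := maxgroupp maxN.
have nsN : N <| QG by rewrite /normal (proper_sub prN) nN.
exists (coset_of N), (QG / N)%G, (fun x => coset N (f x)).
split; first by rewrite quotient_simple.
have nNf x : M x -> f x \in 'N(N) by move=> Mx; apply: (subsetP nN); apply: Qf.
split=> [x y Mx My|x Mx|_ /morphimP[q _ Qq ->]].
- by rewrite fM // morphM ?nNf.
- by rewrite mem_quotient // Qf.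
- by move: Qq; rewrite inE => /asboolP[x Mx <-]; exists x.
Qed.
End Quotient.

Section AbelianSubgroup.
Variables (G : groupType) (H : set G).
Hypotheses (sH : subgroup H) (abH : abelian_subgroup H).

(** A type carrying a commutative law, so that the transfer into a possibly infinite abelian
    subgroup is a big operator. *)
Definition asub := {x : G | H x}.

Lemma asub_inj (u v : asub) : sval u = sval v -> u = v.
Proof. by case: u v => [u Hu] [v Hv] /= E; subst v; congr exist; apply: Prop_irrelevance. Qed.

Definition asub_one : asub := exist _ 1 (proj1 sH).
(* depends on [abH] so that the commutative law below is a canonical structure *)
Definition asub_mul of abelian_subgroup H := fun u v : asub =>
  exist _ _ (subgroupM sH (svalP u) (svalP v)) : asub.

Lemma asub_mulA : associative (asub_mul abH).
Proof. by move=> u v w; apply: asub_inj; rewrite /= mulgA. Qed.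
Lemma asub_mulC : commutative (asub_mul abH).
Proof. by move=> u v; apply: asub_inj; apply: abH; apply: svalP. Qed.
Lemma asub_mul1 : left_id asub_one (asub_mul abH).
Proof. by move=> u; apply: asub_inj; rewrite /= mul1g. Qed.
HB.instance Definition _ :=
  Monoid.isComLaw.Build asub asub_one (asub_mul abH) asub_mulA asub_mulC asub_mul1.
End AbelianSubgroup.

Section Transfer.
Variables (G : groupType) (M : set G) (gT : finGroupType) (S P : {group gT}).
Variable f : G -> gT.
Hypotheses (sM : subgroup M) (hf : onto_hom M S f) (sPS : P \subset S).
Local Notation H := (hpreim M f P).
Hypothesis abH : abelian_subgroup H.
Hypothesis perfM : forall x, M x -> derived_subgroup M x.

Let sH : subgroup H. Proof. exact: subgroup_hpreim hf _. Qed.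
Local Notation op := (asub_mul sH abH).
Local Notation one := (asub_one sH).

(** The transfer [V] into [H], taken over the cosets of [P] in [S], is trivial as [M] is perfect.
    Since [f k = 1], [k] fixes each coset, and since [k] is central each of the [#|S : P|] factors
    equals [k]. *)
Lemma central_transfer k : M k -> f k = 1 -> (forall x, M x -> commute k x) ->
  k ^+ #|S : P| = 1.
Proof.
move=> Mk fk ck; have [fM fin fS] := hf.
have [lift liftP] : exists lift : gT -> G, forall s, s \in S -> M (lift s) /\ f (lift s) = s.
  have /choice[r rP] : forall s, exists x, s \in S -> M x /\ f x = s.
    move=> s; have [Ss|nSs] := boolP (s \in S); last by exists 1.
    by have [x Mx fx] := fS s Ss; exists x.
  by exists r.
pose w (X : {set gT}) m := lift (repr X) * m * (lift (repr (X :* f m)))^-1.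
have rS X : X \in rcosets P S -> repr X \in S.
  case/rcosetsP=> s Ss ->; have := mem_repr_rcoset P s.
  by move/rcosetP=> [y Py ->]; rewrite groupM // (subsetP sPS).
have XS X m : X \in rcosets P S -> M m -> X :* f m \in rcosets P S.
  case/rcosetsP=> s Ss -> Mm; rewrite -rcosetM -rcosetE imset_f // groupM //.
  exact: fin.
have wH X m : X \in rcosets P S -> M m -> H (w X m).
  move=> RX Mm; have RXm := XS X m RX Mm.
  have [Ml fl] := liftP _ (rS _ RX); have [Ml' fl'] := liftP _ (rS _ RXm).
  have MV := subgroupV sM Ml'; have Mlm := subgroupM sM Ml Mm.
  split; first exact: subgroupM.
  rewrite /w fM // fM // (onto_homV sM hf) // fl fl'.
  case/rcosetsP: RX => s Ss ->; rewrite -mem_rcoset -rcosetM rcoset_repr.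
  by rewrite rcosetM mem_rcoset mulgK mem_repr_rcoset.
pose hh X m : asub H := if pselect (H (w X m)) is left h then exist _ _ h else one.
have hhE X m : X \in rcosets P S -> M m -> sval (hh X m) = w X m.
  by move=> RX Mm; rewrite /hh; case: pselect => // n; case: n; apply: wH.
pose V m := \big[op/one]_(X in rcosets P S) hh X m.
have VM m m' : M m -> M m' -> V (m * m') = op (V m) (V m').
  move=> Mm Mm'; rewrite [V m'](reindex_acts 'Rs _ (fin m Mm)) ?actsRs_rcosets //=.
  rewrite /V -big_split /=; apply: eq_bigr => X RX; apply: asub_inj.
  rewrite rcosetE /= !hhE ?XS //; last exact: subgroupM.
  by rewrite /w fM // rcosetM !mulgA mulgKV.
pose N : set G := fun x => M x /\ V x = one.
have V1 : V 1 = one.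
  have M1 : M 1 by case: sM.
  have := VM 1 1 M1 M1; rewrite mulg1 => E; apply: asub_inj.
  by apply: (mulgI (sval (V 1))); rewrite -[LHS]/(sval (op (V 1) (V 1))) -E /= mulg1.
have VV m : M m -> op (V m^-1) (V m) = one.
  by move=> Mm; rewrite -VM ?mulVg //; apply: subgroupV.
have sN : subgroup N.
  apply: subgroup_intro => [|x y [Mx Vx] [My Vy]|x [Mx Vx]].
  - by split=> //; case: sM.
  - split; first exact: subgroupM.
    by rewrite VM // Vx Vy; apply: asub_inj; rewrite /= mulg1.
  - split; first exact: subgroupV.
    by rewrite -(VV x Mx) Vx; apply: asub_inj; rewrite /= mulg1.
have VR x y : M x -> M y -> N [~ x, y].
  move=> Mx My; split; first exact: subgroupR.
  have [Mx' My'] := (subgroupV sM Mx, subgroupV sM My).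
  have Mxy := subgroupM sM Mx My; have Mc := subgroupM sM My' Mxy.
  rewrite commgEl conjgE VM // VM // VM //.
  rewrite (asub_mulA sH abH (V y^-1)) (asub_mulC sH abH (V y^-1)).
  by rewrite -(asub_mulA sH abH (V x)) VV // (asub_mulC sH abH (V x)) asub_mul1 VV.
have : V k = one by case: (derived_ind sN VR (perfM Mk)).
have Hk : H k by split=> //; rewrite fk.
pose u : asub H := exist _ k Hk.
have -> : V k = iter #|S : P| (op u) one.
  rewrite -[X in iter X]/(#|rcosets P S|) -big_const; apply: eq_bigr => X RX.
  apply: asub_inj; rewrite hhE // /w fk rcoset1 /=.
  have [Ml _] := liftP _ (rS _ RX).
  by rewrite -(ck _ Ml) mulgK.
move=> /(congr1 sval) /= <-; elim: #|S : P| => [|n IHn]; first by rewrite expg0.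
by rewrite expgS /= IHn.
Qed.
End Transfer.

(** * Reduction to a finite simple quotient *)

Section Reduction.
Variable G : groupType.
Hypotheses (hlg : locally_graded G) (hins : ~ soluble G) (hpara : parahamiltonian G).
Implicit Types H K : set G.

Lemma hpreimT H (gT : finGroupType) (S : {group gT}) f :
  onto_hom H S f -> hpreim H f S = H.
Proof. by case=> _ fS _; apply/seteqP; split=> x; [case | move=> Hx; split; rewrite ?fS]. Qed.

(** Two noncommuting elements generate [H], so local gradedness gives a finite simple quotient,
    abelian because its proper subgroups are. The kernel is proper, hence abelian, and contains all
    commutators. *)
Lemma minimal_nonabelian_metab H : subgroup H -> minimal_nonabelian H -> metab H.
Proof.
move=> sH [nabH minH].
have [x [y [Hx Hy nxy]]] : exists x y, [/\ H x, H y & x * y <> y * x].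
  apply: contrapT => no; apply: nabH => x y Hx Hy; apply: contrapT => nxy.
  by apply: no; exists x, y.
have fgH : finitely_generated H.
  exists [set x; y]%classic; split; first exact: finite_set2.
  set E := Defs.generated _; have sEH : (E `<=` H)%classic.
    by apply: generated_ind => // z [->|->].
  apply: contrapT => neq; apply: nxy; apply: (minH E).
  - exact: subgroup_generated.
  - by split=> // sHE; apply: neq; apply/seteqP.
  - by apply: sub_generated; left.
  - by apply: sub_generated; right.
have ntH : H <> [set 1]%classic.
  by move=> E; apply: nxy; move: Hx Hy; rewrite E => -> ->.
have [K [sK prK fiK]] := hlg sH fgH ntH.
have [gT [S [f [simS hf]]]] := finite_simple_quotient sH sK prK fiK.
have [fM fin fS] := hf.
have prS (A : {group gT}) : A \proper S -> (hpreim H f A `<` H)%classic.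
  by move=> /(hpreim_proper hf (subxx S)); rewrite (hpreimT hf).
have abS : abelian S.
  apply: simple_proper_abelian simS _ => A prA.
  apply: (abelian_hpreim hf (proper_sub prA)); apply: minH (prS A prA).
  exact: subgroup_hpreim sH hf _.
have pr1 : 1%G \proper S by rewrite proper1G; have /simpleP[] := simS.
have abK := minH _ (subgroup_hpreim sH hf 1%G) (prS _ pr1).
have KR u v : H u -> H v -> hpreim H f 1%G [~ u, v].
  move=> Hu Hv; split; first exact: subgroupR.
  rewrite (onto_homR sH hf) // inE; apply/commgP.
  by apply: (centsP abS); apply: fin.
by move=> u v z w Hu Hv Hz Hw; apply: abK; apply: KR.
Qed.

Lemma abelian_metab H : subgroup H -> abelian_subgroup H -> metab H.
Proof. by move=> sH abH u v z w *; apply: abH; apply: subgroupR. Qed.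

Lemma nonmetab_normal H : subgroup H -> ~ metab H -> normal_subgroup H.
Proof.
move=> sH nmH; apply: contrapT => nn; apply: nmH.
have [_ /(_ H sH nn)[abH|mnaH]] := hpara; first exact: abelian_metab.
exact: minimal_nonabelian_metab.
Qed.

Lemma nonnormal_proper_abelian H K : subgroup H -> ~ normal_subgroup H ->
  subgroup K -> (K `<` H)%classic -> abelian_subgroup K.
Proof.
move=> sH nn sK prK; have [_ /(_ H sH nn)[abH|[_]]] := hpara; last exact.
by move=> x y Kx Ky; apply: abH; apply: prK.1.
Qed.

Local Notation M := (iter 2 (@derived_subgroup G) [set: G]%classic).

Let sM : subgroup M. Proof. exact: subgroup_iter_derived. Qed.
Let nmM : ~ metab M. Proof. exact: insoluble_iter_derived. Qed.

Lemma der2_min H : subgroup H -> ~ metab H -> (M `<=` H)%classic.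
Proof.
move=> sH nmH x; apply: dedekind_derived2 => // K sK HK.
apply: nonmetab_normal => // mK; apply: nmH => u v z w Hu Hv Hz Hw.
by apply: mK; apply: HK.
Qed.

(** By insolubility the next derived subgroup is not metabelian either, so it contains [M]. *)
Lemma der2_perfect x : M x -> derived_subgroup M x.
Proof.
apply: der2_min => //; first exact: subgroup_derived.
exact: (@insoluble_iter_derived _ 3).
Qed.

(** Four elements of [M] with two noncommuting commutators generate a nonmetabelian subgroup, which
    contains [M]. *)
Lemma der2_fg : finitely_generated M.
Proof.
have [x [y [z [w [Mx My Mz Mw nc]]]]] : exists x y z w,
    [/\ M x, M y, M z, M w & ~ commute [~ x, y] [~ z, w]].
  apply: contrapT => no; apply: nmM => x y z w Mx My Mz Mw.
  by apply: contrapT => nc; apply: no; exists x, y, z, w.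
exists ([set x; y] `|` [set z; w])%classic; split.
  by rewrite finite_setU; split; apply: finite_set2.
set A := (_ `|` _)%classic; have sE := subgroup_generated A.
have [Ax Ay Az Aw] : [/\ A x, A y, A z & A w].
  by split; [left; left|left; right|right; left|right; right].
apply/seteqP; split.
  apply: der2_min => // mE; apply: nc.
  by apply: mE; apply: sub_generated.
by apply: generated_ind => // u [[->|->]|[->|->]].
Qed.

Lemma reduction : exists (gT : finGroupType) (S : {group gT}) (f : G -> gT),
  [/\ simple S, ~~ abelian S, onto_hom M S f
    & forall A : {group gT}, A \proper S -> A :!=: 1 ->
       ~ normal_subgroup (hpreim M f A)].
Proof.
have ntM : M <> [set 1]%classic.
  move=> E; apply: nmM => x y z w.
  by rewrite E => -> -> -> ->; exact: commute_refl.
have [K [sK prK fiK]] := hlg sM der2_fg ntM.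
have [gT [S [f [simS hf]]]] := finite_simple_quotient sM sK prK fiK.
exists gT, S, f; split=> //.
  apply/negP => abS; have [fM fin fS] := hf.
  have ker x : M x -> hpreim M f 1%G x.
    move=> /der2_perfect; apply: (@derived_ind _ _ (hpreim M f 1%G)) => [|u v Mu Mv].
      exact: (subgroup_hpreim sM hf 1%G).
    split; first exact: subgroupR sM Mu Mv.
    rewrite (onto_homR sM hf) // inE; apply/commgP.
    by apply: (centsP abS); apply: fin.
  have /simpleP[/trivgPn[s Ss nts] _] := simS; case/negP: nts.
  by have [x /ker[_]] := fS s Ss; rewrite inE => /eqP-> <-.
move=> A prA ntA nA; have := normal_hpreim sM hf (proper_sub prA) nA.
have /simpleP[_ h] := simS; move=> /h[A1|AS]; first by rewrite A1 eqxx in ntA.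
by move: prA; rewrite AS properxx.
Qed.
End Reduction.

End InfiniteReduction.

(** * The quotient is faithful and [M] is the whole group *)

Section FiniteQuotient.
Import GroupScope.

Section Kernel.
Variable G : groupType.
Hypotheses (hlg : locally_graded G) (hins : ~ soluble G) (hpara : parahamiltonian G).
Variables (gT : finGroupType) (S : {group gT}) (f : G -> gT).
Local Notation M := (iter 2 (@derived_subgroup G) [set: G]%classic).
Hypotheses (simS : simple S) (nabS : ~~ abelian S) (hf : onto_hom M S f).
Hypothesis nn : forall A : {group gT}, A \proper S -> A :!=: 1 ->
  ~ normal_subgroup (hpreim M f A).

Let sM : subgroup M. Proof. exact: subgroup_iter_derived. Qed.

Lemma quotient_proper_hpreim (A B : {group gT}) : A \proper S -> B \proper A ->
  abelian_subgroup (hpreim M f B).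
Proof.
move=> prA prB; have ntA : A :!=: 1.
  by apply: contraTneq prB => ->; rewrite properE sub1G andbF.
apply: (nonnormal_proper_abelian hpara _ (nn prA ntA)).
- exact: subgroup_hpreim sM hf _.
- exact: subgroup_hpreim sM hf _.
- exact: (hpreim_proper hf (proper_sub prA) prB).
Qed.

Lemma quotient_ab2 (A B : {group gT}) : A \proper S -> B \proper A -> abelian B.
Proof.
move=> prA prB; apply: (abelian_hpreim hf _ (quotient_proper_hpreim prA prB)).
exact: subset_trans (proper_sub prB) (proper_sub prA).
Qed.

(** [R] is properly contained in its normaliser by transfer, and the preimage of that normaliser is
    not normal, so its proper subgroups are abelian. *)
Lemma Sylow_hpreim p (R : {group gT}) : p.-Sylow(S) R -> R :!=: 1 ->
  abelian_subgroup (hpreim M f R).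
Proof.
move=> sylR ntR; have abR := Sylow_abelian simS nabS quotient_ab2 sylR.
have prN := norm_proper simS ntR (Sylow_proper simS nabS sylR).
apply: (@quotient_proper_hpreim 'N_S(R)%G) => //.
rewrite properE subsetI (pHall_sub sylR) normG /=.
apply: contra (simple_Sylow_norm_cent simS nabS sylR ntR abR) => sNR.
exact: subset_trans sNR abR.
Qed.

Lemma kernel_central k m : M k -> f k = 1 -> M m -> commute k m.
Proof.
move=> Mk fk Mm; have [fM fin fS] := hf.
have [p [R [sylR ntR Rm]]] : exists p (R : {group gT}),
    [/\ p.-Sylow(S) R, R :!=: 1 & f m \in R].
  have [fm1|nfm] := eqVneq (f m) 1.
    have pS : pdiv #|S| \in \pi(S) by rewrite pi_pdiv cardG_gt1 (simple_nt nabS).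
    by exists (pdiv #|S|), (syl S (pdiv #|S|)); rewrite sylP syl_nt // fm1 group1.
  have Sm : f m \in S^# by apply/setD1P; rewrite fin.
  have [p [R [_ sylR /setD1P[_ Rm]]]] := elt_in_Sylow simS nabS quotient_ab2 Sm.
  by exists p, R; split=> //; apply/trivgPn; exists (f m).
by apply: (Sylow_hpreim sylR ntR); split; rewrite ?fk.
Qed.

Lemma kernel_trivial k : M k -> f k = 1 -> k = 1.
Proof.
move=> Mk fk.
have oS : #|S| = 60.
  by rewrite (card_isog (simple_ab2_Alt5 simS nabS quotient_ab2)) card_Alt5.
have kX p : p \in \pi(S) -> k ^+ #|S : syl S p| = 1.
  move=> pS; apply: (central_transfer sM hf (pHall_sub (sylP S p))) => //.
  - exact: Sylow_hpreim (sylP S p) (syl_nt pS).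
  - exact: der2_perfect hlg hins hpara.
  - by move=> x; apply: kernel_central.
have idx p : (#|S : syl S p| = 60 %/ p ^ logn p 60)%N.
  rewrite -divgS ?(pHall_sub (sylP S p)) // (card_Hall (sylP S p)) p_part.
  by rewrite oS.
have pS p : prime p -> (p %| 60)%N -> p \in \pi(S).
  by move=> pp pd; rewrite mem_primes pp cardG_gt0 /= oS.
(* The indices 60/4, 60/3 and 60/5 have greatest common divisor 1. *)
have k15 : k ^+ 15 = 1 by have := kX 2 (pS 2 isT isT); rewrite idx.
have k20 : k ^+ 20 = 1 by have := kX 3 (pS 3 isT isT); rewrite idx.
have k12 : k ^+ 12 = 1 by have := kX 5 (pS 5 isT isT); rewrite idx.
have k3 : k ^+ 3 = 1 by move: k15; rewrite (expgnDr k 12 3) k12 mul1g.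
have k2 : k ^+ 2 = 1.
  by move: k20; rewrite (expgnDr k (3 * 6) 2) expgnA k3 expg1n mul1g.
by move: k3; rewrite (expgnDr k 2 1) k2 mul1g expg1.
Qed.

Lemma quotient_inj x y : M x -> M y -> f x = f y -> x = y.
Proof.
move=> Mx My E; have [fM _ _] := hf; have My' := subgroupV sM My.
apply: (mulIg y^-1); rewrite mulgV; apply: kernel_trivial.
  exact: (subgroupM sM Mx My').
by rewrite fM // (onto_homV sM hf) // E mulgV.
Qed.

(* Frattini argument: conjugation by x induces an automorphism of S, hence
   x is in M times the normaliser of the preimage of a Sylow subgroup P; that
   normaliser is not normal in G, so its proper subgroups are abelian, and it
   equals the preimage of N(P), which is not abelian. *)
Lemma der2_setT x : M x.
Proof.
have nM y g : M y -> M (y ^ g).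
  have := nonmetab_normal hlg hpara sM (@insoluble_iter_derived _ 2 hins).
  by move=> h; apply: (h y g).
have [fM fin fS] := hf.
have [s sP] : exists s : gT -> G, forall a, a \in S -> M (s a) /\ f (s a) = a.
  have /choice[r rP] : forall a, exists x, a \in S -> M x /\ f x = a.
    move=> a; have [Sa|nSa] := boolP (a \in S); last by exists 1.
    by have [y My fy] := fS a Sa; exists y.
  by exists r.
pose p := pdiv #|S|.
have pS : p \in \pi(S) by rewrite pi_pdiv cardG_gt1 (simple_nt nabS).
pose P := syl S p; have sylPp : p.-Sylow(S) P := sylP S p.
have ntP : P :!=: 1 := syl_nt pS.
have prP := Sylow_proper simS nabS sylPp.
have sPS := proper_sub prP.
have prN := norm_proper simS ntP prP.
(* The normaliser in [G] of the preimage of [P]; it meets [M] in the preimage of ['N_S(P)]. *)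
pose NG : set G := fun g => forall y, hpreim M f P y <-> hpreim M f P (y ^ g).
have sNG : subgroup NG.
  apply: subgroup_intro => [y|g h Ng Nh y|g Ng y]; first by rewrite conjg1.
  - by rewrite conjgM; apply: iff_trans (Ng y) (Nh _).
  - by have := Ng (y ^ g^-1); rewrite conjgKV => h; apply: iff_sym.
have NGM g : M g -> NG g <-> f g \in 'N(P).
  move=> Mg; split=> [Ng|nPg y].
    rewrite inE; apply/subsetP=> _ /imsetP[a Pa ->].
    have [Ma fa] := sP a (subsetP sPS a Pa).
    have [h _] := Ng (s a); have [|_] := h; first by split; rewrite ?fa.
    by rewrite (onto_homJ sM hf) // fa.
  split=> -[My Py].
    by split; [apply: nM | rewrite (onto_homJ sM hf) // memJ_norm].
  have My' : M y by rewrite -(conjgK g y); apply: nM.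
  by split=> //; move: Py; rewrite (onto_homJ sM hf) // memJ_norm.
have nNG : ~ normal_subgroup NG.
  move=> nNG; apply: (nn prN) => [|y g [My]].
    have : gval P \subset 'N_S(P) by rewrite subsetI sPS normG.
    by move=> sPN; apply: contraNneq ntP => E; rewrite -subG1 -E.
  rewrite inE => /andP[Sy Ny]; have Myg : M (y ^ g) by apply: nM.
  split=> //; rewrite inE fin //=; apply/(NGM _ Myg).
  by apply: nNG; apply/(NGM _ My).
have NG_M g : NG g -> M g.
  move=> Ng; apply: contrapT => nMg.
  have abN : abelian_subgroup (hpreim M f 'N_S(P)%G).
    apply: (nonnormal_proper_abelian hpara sNG nNG).
      exact: (subgroup_hpreim sM hf 'N_S(P)%G).
    split=> [y [My]|h]; first by rewrite inE => /andP[_ Ny]; apply/NGM.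
    by case: (h g Ng).
  have abN' : abelian 'N_S(P) := abelian_hpreim hf (subsetIl _ _) abN.
  have abP := Sylow_abelian simS nabS quotient_ab2 sylPp.
  case/negP: (simple_Sylow_norm_cent simS nabS sylPp ntP abP).
  by apply: subset_trans abN' (centS _); rewrite subsetI sPS normG.
(* The choice of the lift [s] is harmless because [f] is injective on [M]. *)
pose psi a := f (s a ^ x).
have psiM : {in S &, {morph psi : a b / a * b}}.
  move=> a b Sa Sb; have [[Ma fa] [Mb fb]] := (sP a Sa, sP b Sb).
  have [Mab fab] := sP _ (groupM Sa Sb).
  rewrite /psi -fM; try exact: nM.
  rewrite -conjMg; congr (f (_ ^ x)); apply: quotient_inj => //.
    exact: (subgroupM sM Ma Mb).
  by rewrite fab fM // fa fb.
have psiS a : a \in S -> psi a \in S.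
  by move=> Sa; apply: fin; apply: nM; case: (sP a Sa).
have inj_psi : 'injm (Morphism psiM).
  apply/injmP=> a b Sa Sb /= E; have [[Ma fa] [Mb fb]] := (sP a Sa, sP b Sb).
  have /conjg_inj Eab : s a ^ x = s b ^ x by apply: quotient_inj => //; apply: nM.
  by rewrite -fa -fb Eab.
have sylPsi : p.-Sylow(S) (Morphism psiM @* P)%G.
  rewrite pHallE /= card_injm // (card_Hall sylPp) eqxx andbT.
  by apply/subsetP=> _ /morphimP[a Sa Pa ->]; apply: psiS.
have [m Sm Em] := Sylow_trans sylPp sylPsi.
have [Mm fm] := sP m Sm; have Mm' := subgroupV sM Mm.
have memE y : M y -> f (y ^ x) \in P :^ m <-> f y \in P.
  move=> My; rewrite -Em; split=> [/morphimP[a Sa Pa E]|Py].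
    have [Ma fa] := sP a Sa.
    have /conjg_inj -> : y ^ x = s a ^ x by apply: quotient_inj => //; apply: nM.
    by rewrite fa.
  have Sy := subsetP sPS _ Py; have [Ma fa] := sP _ Sy.
  apply/morphimP; exists (f y) => //; rewrite /= /psi.
  by congr (f (_ ^ x)); apply: quotient_inj.
have Nn : NG (x * (s m)^-1).
  move=> y; have yE : y ^ (x * (s m)^-1) = (y ^ x) ^ (s m)^-1 by rewrite conjgM.
  rewrite yE; split=> -[My Py].
    have Myx : M (y ^ x) by apply: nM.
    split; first exact: nM.
    by rewrite (onto_homJ sM hf) // (onto_homV sM hf) // fm -mem_conjg; apply/memE.
  have Myx : M (y ^ x) by rewrite -(conjgKV (s m) (y ^ x)); apply: nM.
  have My' : M y by rewrite -(conjgK x y); apply: nM.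
  split=> //; apply/memE => //; rewrite mem_conjg -fm.
  by move: Py; rewrite (onto_homJ sM hf) // (onto_homV sM hf).
by have := subgroupM sM (NG_M _ Nn) Mm; rewrite mulgKV.
Qed.

End Kernel.

End FiniteQuotient.

Theorem corollary3p9 (G : groupType) (hlg : locally_graded G)
  (hins : ~ soluble G) (hpara : parahamiltonian G) :
  isomorphic G [subg 'Alt_('I_5)].
Proof.
have [gT [S [f [simS nabS hf nn]]]] := reduction hlg hins hpara.
have MT x := der2_setT hlg hins hpara simS nabS hf nn x.
have f_inj x y : f x = f y -> x = y.
  exact: (quotient_inj hlg hins hpara simS nabS hf nn (MT x) (MT y)).
have [fM fin fS] := hf.
have /isogP[h injh hS] := simple_ab2_Alt5 simS nabS (quotient_ab2 hpara hf nn).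
have hA x : h (f x) \in ('Alt_('I_5))%g by rewrite -hS mem_morphim ?fin.
pose F (x : G) : [subg 'Alt_('I_5)] := subg ('Alt_('I_5))%G (h (f x)).
have FM : {morph F : x y / (x * y)%g}.
  by move=> x y; rewrite /F fM // morphM ?fin // subgM.
pose FF := HB.pack_for {multiplicative G -> [subg 'Alt_('I_5)]} F
  (isMultiplicative.Build _ _ F FM).
exists FF.
have F_inj : injective F.
  move=> x y /(congr1 sgval); rewrite !subgK // => E; apply: f_inj.
  by apply: (injmP injh) E; apply: fin.
have /choice[g gP] : forall a : [subg 'Alt_('I_5)], exists x, F x = a.
  move=> a; have : sgval a \in (h @* S)%g by rewrite hS subgP.
  case/morphimP=> b Sb _ E; have [x Mx fx] := fS b Sb.
  by exists x; apply: val_inj; rewrite /F fx -E sgvalK.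
by exists g => [x|a]; [apply: F_inj; rewrite gP | apply: gP].
Qed.
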